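(* Let $c\ge 0$ and let $M$ be a $d$-dimensional and $c$-connected closed PL-manifold. Then $$\Delta^{PL}(M)\ \ge\ 1+d+c\cdot(\mathrm{cat}(M)-2)+\tfrac12\,\mathrm{cat}(M)\,(\mathrm{cat}(M)-1).$$
   Context: For a PL-manifold $M$, $\Delta^{PL}(M)$ is the minimal number of vertices of a combinatorial (PL-) triangulation of $M$, i.e. a triangulation in which the links of all vertices are combinatorial spheres. A subset $A\subseteq X$ is categorical if the inclusion $A\hookrightarrow X$ is homotopic to a constant map. The Lusternik–Schnirelmann category $\mathrm{cat}(X)$ is the minimal $n$ for which $X$ can be covered by $n$ open categorical subsets (non-normalized: a contractible space has category $1$). *)

(* Defs.v *)
From HB Require Import structures.
From mathcomp Require Import all_boot all_order all_algebra.
From mathcomp Require Import all_classical all_reals all_analysis.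

Set Implicit Arguments.
Unset Strict Implicit.
Unset Printing Implicit Defensive.

Import Order.TTheory GRing.Theory Num.Theory.
Import numFieldNormedType.Exports.

Local Open Scope classical_set_scope.
Local Open Scope ring_scope.

(* Functions are total; only their values on the sets [A] and [B] matter. *)
Definition homeomorphism_on (X Y : topologicalType) (A : set X) (B : set Y)
    (f : X -> Y) (g : Y -> X) : Prop :=
  [/\ {within A, continuous f}, {within B, continuous g},
      (forall x, A x -> B (f x) /\ g (f x) = x) &
      (forall y, B y -> A (g y) /\ f (g y) = y)].

(* [f] and [g] are homotopic as maps from the subspace [A] to [Y], relative to
   [B]. *)
Definition homotopic_rel (R : realType) (X Y : topologicalType) (A B : set X)
    (f g : X -> Y) : Prop :=
  exists H : R * X -> Y,
    [/\ {within `[0, 1]%classic `*` A, continuous H},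
        (forall x, A x -> H (0, x) = f x),
        (forall x, A x -> H (1, x) = g x) &
        (forall t x, 0 <= t <= 1 -> B x -> H (t, x) = f x)].

Definition cube (R : realType) (i : nat) : set 'rV[R]_i :=
  [set x | forall j, 0 <= x 0 j <= 1].

Definition cube_boundary (R : realType) (i : nat) : set 'rV[R]_i :=
  [set x | cube x /\ exists j, x 0 j = 0 \/ x 0 j = 1].

(* [pi_i (X, x0)], the set of homotopy classes rel boundary of maps
   [(I^i, boundary) -> (X, x0)], is trivial.  The cube [I^0] is a point with
   empty boundary, so for [i = 0] this says that every point of [X] can be
   joined to [x0] by a path. *)
Definition trivial_homotopy_set (R : realType) (X : topologicalType) (i : nat)
    (x0 : X) : Prop :=
  forall f : 'rV[R]_i -> X,
    {within @cube R i, continuous f} ->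
    (forall x, cube_boundary x -> f x = x0) ->
    @homotopic_rel R _ _ (@cube R i) (@cube_boundary R i) f (cst x0).

Definition n_connected (R : realType) (c : nat) (X : topologicalType) : Prop :=
  [set: X] !=set0 /\
  forall (i : nat) (x0 : X), (i <= c)%N -> @trivial_homotopy_set R X i x0.

Definition categorical (R : realType) (X : topologicalType) (A : set X) : Prop :=
  exists x0 : X, @homotopic_rel R _ _ A set0 id (cst x0).

(* The least element of [S], and [+oo] when [S] is empty. *)
Definition least (R : realType) (S : set nat) : \bar R :=
  ereal_inf [set n%:R%:E | n in S].

(* The Lusternik-Schnirelmann category, non-normalized. *)
Definition lscat (R : realType) (X : topologicalType) : \bar R :=
  @least R [set n | exists U : 'I_n -> set X,
    (forall i, open (U i) /\ @categorical R X (U i)) /\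
    \bigcup_i U i = [set: X]].

Definition polyhedral_set (R : realType) (m : nat) (P : set 'rV[R]_m) : Prop :=
  exists (k : nat) (A : 'M[R]_(m, k)) (b : 'rV[R]_k),
    P = [set x | forall j, (x *m A) 0 j <= b 0 j].

Definition affine_on (R : realType) (m n : nat) (P : set 'rV[R]_m)
    (f : 'rV[R]_m -> 'rV[R]_n) : Prop :=
  exists (A : 'M[R]_(m, n)) (b : 'rV[R]_n), forall x, P x -> f x = x *m A + b.

(* [f] is piecewise linear on [X]: every point of [X] has a neighborhood in [X]
   that is a finite union of polyhedral sets on each of which [f] is affine. *)
Definition pl_on (R : realType) (m n : nat) (X : set 'rV[R]_m)
    (f : 'rV[R]_m -> 'rV[R]_n) : Prop :=
  forall x, X x ->
    exists C : set (set 'rV[R]_m),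
      [/\ finite_set C,
          (forall P, C P -> [/\ polyhedral_set P, P `<=` X & affine_on P f]) &
          within X (nbhs x) (\bigcup_(P in C) P)].

Definition pl_homeomorphic (R : realType) (m n : nat)
    (A : set 'rV[R]_m) (B : set 'rV[R]_n) : Prop :=
  exists (f : 'rV[R]_m -> 'rV[R]_n) (g : 'rV[R]_n -> 'rV[R]_m),
    [/\ homeomorphism_on A B f g, pl_on A f & pl_on B g].

(* A homeomorphism from an open set [chart_dom] of [M] onto an open subset of
   [R^d]; outside of these sets, the values of [chart_fun] and [chart_inv] are
   irrelevant. *)
Record chart (R : realType) (d : nat) (M : topologicalType) := Chart {
  chart_dom : set M;
  chart_codom : set 'rV[R]_d;
  chart_fun : M -> 'rV[R]_d;
  chart_inv : 'rV[R]_d -> M;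
  chart_dom_open : open chart_dom;
  chart_codom_open : open chart_codom;
  chart_homeomorphism :
    homeomorphism_on chart_dom chart_codom chart_fun chart_inv
}.

(* Transition maps in the reverse direction are obtained by exchanging [a] and
   [b].  The atlas need not be maximal. *)
Definition pl_atlas (R : realType) (d : nat) (M : topologicalType)
    (A : set (chart R d M)) : Prop :=
  \bigcup_(a in A) chart_dom a = [set: M] /\
  forall a b, A a -> A b ->
    pl_on (chart_fun a @` (chart_dom a `&` chart_dom b))
          (chart_fun b \o chart_inv a).

Record closedPLManifold (R : realType) (d : nat) := ClosedPLManifold {
  plm_space :> topologicalType;
  plm_hausdorff : hausdorff_space plm_space;
  plm_second_countable : @second_countable plm_space;
  plm_compact : compact [set: plm_space];
  plm_atlas : set (chart R d plm_space);
  plm_atlasP : pl_atlas plm_atlas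
}.

(* The empty simplex belongs to the complex, so that the link of an isolated
   vertex is [{set0}], the (-1)-dimensional sphere. *)
Definition simplicial_complex (V : finType) (K : {set {set V}}) : Prop :=
  [/\ finset.set0 \in K,
      (forall v : V, [set v]%SET \in K) &
      (forall s t : {set V}, s \in K -> t \subset s -> t \in K)].

Definition link (V : finType) (K : {set {set V}}) (v : V) : {set {set V}} :=
  [set s : {set V} | (v \notin s) && ((v |: s)%SET \in K)]%SET.

(* Barycentric coordinates.  Indices that are not vertices of [K] are allowed
   (this occurs for links); their coordinates vanish. *)
Definition realization (R : realType) (n : nat) (K : {set {set 'I_n}}) :
    set 'rV[R]_n :=
  [set x | [/\ forall i, 0 <= x 0 i, \sum_i x 0 i = 1 &
               [set i | x 0 i != 0]%SET \in K]].

Definition simplex_boundary (d : nat) : {set {set 'I_d.+1}} :=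
  [set s : {set 'I_d.+1} | s != [set: 'I_d.+1]%SET]%SET.

(* Combinatorial spheres of dimension [d - 1]. *)
Definition combinatorial_sphere (R : realType) (d n : nat)
    (L : {set {set 'I_n}}) : Prop :=
  pl_homeomorphic (@realization R n L) (@realization R d.+1 (simplex_boundary d)).

(* [K], with vertex set ['I_n], is a combinatorial triangulation of the
   [d]-manifold underlying [M].  The homeomorphism is not required to be
   piecewise linear with respect to the atlas of [M]. *)
Definition combinatorial_triangulation (R : realType) (d : nat)
    (M : closedPLManifold R d) (n : nat) (K : {set {set 'I_n}}) : Prop :=
  [/\ simplicial_complex K,
      (exists (f : 'rV[R]_n -> M) (g : M -> 'rV[R]_n),
         homeomorphism_on (@realization R n K) [set: M] f g) &
      (forall v : 'I_n, @combinatorial_sphere R d n (link K v))].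

Definition DeltaPL (R : realType) (d : nat) (M : closedPLManifold R d) : \bar R :=
  @least R [set n | exists K : {set {set 'I_n}}, combinatorial_triangulation M K].

(* Main.v *)
Require Import Defs.
From HB Require Import structures.
From mathcomp Require Import all_boot all_order all_algebra.
From mathcomp Require Import all_classical all_reals all_analysis.
From mathcomp Require Import ring lra zify.

(** Let [K] be a combinatorial triangulation of [M] with [n] vertices, and view
    [M] as the realization of [K].  The plan is to cover [M] by few open sets
    whose inclusion into [M] is null-homotopic, and to charge each of them to
    some vertices of [K].

    The open star of a simplex, which is the set of points having a nonzero
    coordinate at one of its vertices, deforms onto the simplex and is therefore
    categorical ([open_star_nullhomotopic]).  Because the vertex links are
    combinatorial [(d-1)]-spheres, [K] contains a simplex with [d + 1] vertices
    ([triangulation_simplex]); its star is the first set.  The remaining points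
    have a nonzero coordinate in the set [W] of remaining vertices.  To cover
    them by [k] sets, there are two cases ([greedy_null_coverable]).  If [W]
    spans a simplex with at least [c + k + 1] vertices, its star is taken as one
    of the [k] sets, and [k - 1] sets remain for a vertex set that is smaller by
    [c + k + 1].  If not, [W] spans a complex of dimension less than [c + k],
    and [k] sets suffice without any counting ([low_dim_null_coverable]): one
    for a neighborhood of its [c]-skeleton, and one for each dimension
    [c + 1, ..., c + k - 1], which collects the disjoint neighborhoods of the
    barycenters of the simplices of that dimension.  Adding up,
    [n < 1 + d + c (k - 1) + k (k + 1) / 2] implies that [k] sets cover [M],
    which is the assertion for [k = cat M - 1].

    Connectivity enters through [skeleton_nullhomotopic]: the inclusion of the
    [c]-skeleton into a [c]-connected space is null-homotopic.  The cone over a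
    simplicial complex is a union of faces of the cube [[0,1]^n], on which the
    map is extended face by face; a face with [j + 1] coordinates needs exactly
    that maps from the boundary of the [(j+1)]-cube extend to the cube, and this
    follows from the triviality of [pi_j] ([extend_from_boundary]).

    The dimension of [K] comes from [combinatorial_sphere_dim]: a piecewise
    linear injection cannot map a piece of an affine [(d-1)]-space into a
    finite union of affine spaces of smaller dimension.  Points of a moment
    curve are used to see this, since any [d] of them are independent. *)

Set Implicit Arguments.
Unset Strict Implicit.
Unset Printing Implicit Defensive.

Import Order.TTheory GRing.Theory Num.Theory.
Import numFieldNormedType.Exports.

Local Open Scope classical_set_scope.
Local Open Scope ring_scope.

(** * Continuity on subsets *)

Section Within.
Context {X : topologicalType}.

Lemma within_comp {Y Z : topologicalType} (A : set X) (B : set Y)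
    (f : X -> Y) (g : Y -> Z) :
  {within A, continuous f} -> (forall x, A x -> B (f x)) ->
  {within B, continuous g} -> {within A, continuous (g \o f)}.
Proof.
move=> /subspace_continuousP cf AB /subspace_continuousP cg.
apply/subspace_continuousP => x Ax V /(cg _ (AB _ Ax)) /(cf _ Ax).
rewrite /nbhs /= /fmap /within /=.
by apply: filterS => y h Ay; apply: h Ay (AB _ Ay).
Qed.

Lemma within_eq {Y : topologicalType} (A : set X) (f g : X -> Y) :
  {within A, continuous f} -> (forall x, A x -> f x = g x) ->
  {within A, continuous g}.
Proof. by move=> cf fg; move: cf; apply: subspace_eq_continuous => x /set_mem /fg. Qed.

Lemma within_comp_continuous {Y Z : topologicalType} (A : set X)
    (f : X -> Y) (g : Y -> Z) :
  {within A, continuous f} -> continuous g -> {within A, continuous (g \o f)}.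
Proof.
move=> cf cg; apply: (@within_comp _ _ _ setT) => //.
exact: continuous_subspaceT.
Qed.

Lemma within_pair {Y Z : topologicalType} (A : set X) (f : X -> Y) (g : X -> Z) :
  {within A, continuous f} -> {within A, continuous g} ->
  {within A, continuous (fun x => (f x, g x))}.
Proof.
move=> /subspace_continuousP cf /subspace_continuousP cg.
by apply/subspace_continuousP => x Ax; apply: cvg_pair; [apply: cf|apply: cg].
Qed.

(** The closed pieces cover [A] only, and [A] itself is arbitrary: homotopies
    are glued below over open sets and over subsets of realizations. *)
Lemma within_paste {Y : topologicalType} (A C1 C2 : set X) (f : X -> Y) :
  closed C1 -> closed C2 -> A `<=` C1 `|` C2 ->
  {within A `&` C1, continuous f} -> {within A `&` C2, continuous f} ->
  {within A, continuous f}.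
Proof.
move=> cl1 cl2 Acov /subspace_continuousP c1 /subspace_continuousP c2.
apply/subspace_continuousP => x Ax V Vf.
have key (C : set X) : closed C ->
    (forall x, (A `&` C) x -> f @ within (A `&` C) (nbhs x) --> f x) ->
    \forall y \near x, A y -> C y -> V (f y).
  move=> clC cC; have [Cx|nCx] := pselect (C x).
    have := cC x (conj Ax Cx) V Vf.
    rewrite /nbhs /= /fmap /within /=.
    by apply: filterS => y h Ay Cy; apply: h.
  have : nbhs x (~` C) by apply: open_nbhs_nbhs; split; first exact: closed_openC.
  by apply: filterS => y nCy _ /nCy.
suff: \forall y \near x, A y -> V (f y) by [].
apply: filterS (filterI (key _ cl1 c1) (key _ cl2 c2)) => y [h1 h2] Ay.
by case: (Acov _ Ay) => ?; [apply: h1|apply: h2].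
Qed.

Lemma within_if {Y : topologicalType} (A C1 C2 : set X) (f g : X -> Y) :
  closed C1 -> closed C2 -> A `<=` C1 `|` C2 ->
  {within A `&` C1, continuous f} -> {within A `&` C2, continuous g} ->
  (forall x, A x -> C1 x -> C2 x -> f x = g x) ->
  {within A, continuous (fun x => if x \in C1 then f x else g x)}.
Proof.
move=> cl1 cl2 Acov cf cg fg; apply: (within_paste cl1 cl2 Acov).
  by apply: (within_eq cf) => x [Ax C1x]; rewrite mem_set.
apply: (within_eq cg) => x [Ax C2x]; case: ifPn => // /set_mem C1x.
by rewrite fg.
Qed.

Variable R : realType.
Variable A : set X.

Lemma within_op (op : R -> R -> R) (f g : X -> R) :
  continuous (fun z : R * R => op z.1 z.2) ->
  {within A, continuous f} -> {within A, continuous g} ->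
  {within A, continuous (fun x => op (f x) (g x))}.
Proof.
move=> cop cf cg.
exact: (within_comp_continuous (within_pair cf cg) cop).
Qed.

Lemma within_cst {Y : topologicalType} (a : Y) :
  {within A, continuous (fun _ : X => a)}.
Proof. by apply: continuous_subspaceT => x; apply: cvg_cst. Qed.

Lemma within_add (f g : X -> R) :
  {within A, continuous f} -> {within A, continuous g} ->
  {within A, continuous (fun x => f x + g x)}.
Proof. exact/within_op/add_continuous. Qed.

Lemma within_mul (f g : X -> R) :
  {within A, continuous f} -> {within A, continuous g} ->
  {within A, continuous (fun x => f x * g x)}.
Proof. exact/within_op/mul_continuous. Qed.

Lemma within_max (f g : X -> R) :
  {within A, continuous f} -> {within A, continuous g} ->
  {within A, continuous (fun x => Num.max (f x) (g x))}.
Proof. exact/within_op/max_continuous. Qed.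

Lemma within_opp (f : X -> R) :
  {within A, continuous f} -> {within A, continuous (fun x => - f x)}.
Proof. by move=> cf; apply: (within_comp_continuous cf); apply: opp_continuous. Qed.

Lemma within_sub_fun (f g : X -> R) :
  {within A, continuous f} -> {within A, continuous g} ->
  {within A, continuous (fun x => f x - g x)}.
Proof. by move=> cf cg; apply: within_add => //; apply: within_opp. Qed.

Lemma within_inv (f : X -> R) : (forall x, A x -> f x != 0) ->
  {within A, continuous f} -> {within A, continuous (fun x => (f x)^-1)}.
Proof.
move=> f0 cf.
apply: (@within_comp _ _ _ [set y | y != 0] f (fun y : R => y^-1)) => //.
apply/subspace_continuousP => y y0; apply: cvg_within_filter.
exact: inv_continuous.
Qed.

Lemma within_sum (I : Type) (r : seq I) (P : pred I) (F : I -> X -> R) :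
  (forall i, P i -> {within A, continuous (F i)}) ->
  {within A, continuous (fun x => \sum_(i <- r | P i) F i x)}.
Proof. exact/continuous_big/add_continuous. Qed.

Lemma within_prod (I : Type) (r : seq I) (P : pred I) (F : I -> X -> R) :
  (forall i, P i -> {within A, continuous (F i)}) ->
  {within A, continuous (fun x => \prod_(i <- r | P i) F i x)}.
Proof. exact/continuous_big/mul_continuous. Qed.

Lemma within_coord m n (f : X -> 'M[R]_(m, n)) i j :
  {within A, continuous f} -> {within A, continuous (fun x => f x i j)}.
Proof.
move=> cf; apply: (@within_comp_continuous _ _ _ f (fun M : 'M[R]_(m, n) => M i j)) => //.
exact: coord_continuous.
Qed.

Lemma within_mx m n (f : X -> 'M[R]_(m, n)) :
  (forall i j, {within A, continuous (fun x => f x i j)}) ->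
  {within A, continuous f}.
Proof.
move=> cf; apply/subspace_continuousP => x Ax.
apply/cvg_mx_entourageP => E entE.
apply: filter_forall => i; apply: filter_forall => j.
have /subspace_continuousP /(_ x Ax) := cf i j.
move=> /cvg_entourageP /(_ E entE) h.
have {}h : within A (nbhs x) (fun y => E (f x i j, f y i j)) := h.
suff: within A (nbhs x) (fun y => (f x i j, f y i j) \in E) by [].
by apply: filterS h => y Exy; rewrite inE.
Qed.

End Within.

(** * Homotopies *)

Lemma within_local {X Y : topologicalType} (A : set X) (f : X -> Y) :
  (forall x, A x -> exists U, [/\ open U, U x & {within A `&` U, continuous f}]) ->
  {within A, continuous f}.
Proof.
move=> loc; apply/subspace_continuousP => x Ax V Vf.
have [U [oU Ux /subspace_continuousP cf]] := loc x Ax.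
have h : nbhs x (fun y => (A `&` U) y -> V (f y)) := cf x (conj Ax Ux) V Vf.
have hU : nbhs x U by apply: open_nbhs_nbhs.
suff: nbhs x (fun y => A y -> V (f y)) by [].
by apply: filterS2 h hU => y h Uy Ay; apply: h.
Qed.

Section Homotopy.
Variable R : realType.

Local Notation homotopic A f g := (@homotopic_rel R _ _ A set0 f g).

Definition nullhomotopic {X Y : topologicalType} (A : set X) (f : X -> Y) :=
  exists y0, @homotopic_rel R _ _ A set0 f (cst y0).

Definition paths_exist (Y : topologicalType) := forall a b : Y,
  exists p : R -> Y, [/\ {within `[0, 1]%classic, continuous p}, p 0 = a & p 1 = b].

Lemma within_fst {X Y : topologicalType} (A : set (X * Y)) :
  {within A, continuous fst}.
Proof. by apply: continuous_subspaceT => x; apply: cvg_fst. Qed.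

Lemma within_snd {X Y : topologicalType} (A : set (X * Y)) :
  {within A, continuous snd}.
Proof. by apply: continuous_subspaceT => x; apply: cvg_snd. Qed.

Lemma homotopic_pullback {X Y Z : topologicalType} (A : set X) (B : set Y)
    (r : X -> Y) (f g : Y -> Z) :
  {within A, continuous r} -> (forall x, A x -> B (r x)) ->
  homotopic B f g -> homotopic A (f \o r) (g \o r).
Proof.
move=> cr AB [H [cH H0 H1 _]]; exists (fun p => H (p.1, r p.2)); split.
- refine (within_comp (f := fun p : R * X => (p.1, r p.2)) _ _ cH).
    apply: within_pair; first exact: within_fst.
    refine (within_comp (f := snd) _ _ cr); first exact: within_snd.
    by case=> t x [].
  by case=> t x [/= ? /AB].
- by move=> x Ax; apply/H0/AB.
- by move=> x Ax; apply/H1/AB.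
- by [].
Qed.

Lemma homotopic_sub {X Y : topologicalType} (A B : set X) (f g : X -> Y) :
  A `<=` B -> homotopic B f g -> homotopic A f g.
Proof.
have cid : {within A, continuous (@idfun X)}.
  by apply: continuous_subspaceT => x; apply: cvg_id.
by move=> AB; apply: (homotopic_pullback cid).
Qed.

Lemma homotopic_eql {X Y : topologicalType} (A : set X) (f f' g : X -> Y) :
  (forall x, A x -> f x = f' x) -> homotopic A f g -> homotopic A f' g.
Proof.
move=> ff' [H [cH H0 H1 _]]; exists H; split=> // x Ax.
by rewrite H0 // ff'.
Qed.

Lemma homotopic_trans {X Y : topologicalType} (A : set X) (f g h : X -> Y) :
  homotopic A f g -> homotopic A g h -> homotopic A f h.
Proof.
move=> [H [cH H0 H1 _]] [H' [cH' H'0 H'1 _]].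
pose C1 := [set p : R * X | p.1 <= 1 / 2]; pose C2 := [set p : R * X | 1 / 2 <= p.1].
have cfst : continuous (fst : R * X -> R) by move=> x; apply: cvg_fst.
have cl1 : closed C1.
  by apply: (@preimage_closed _ _ fst [set t : R | t <= 1 / 2]) => //; exact: closed_le.
have cl2 : closed C2.
  by apply: (@preimage_closed _ _ fst [set t : R | 1 / 2 <= t]) => //; exact: closed_ge.
have scale (a b : R) (B : set (R * X)) :
    {within B, continuous (fun p : R * X => (a * p.1 + b, p.2))}.
  apply: within_pair; last exact: within_snd.
  apply: within_add; last exact: within_cst.
  by apply: within_mul; [exact: within_cst|exact: within_fst].
exists (fun p => if p \in C1 then H (2 * p.1 + 0, p.2) else H' (2 * p.1 + (- 1), p.2)).
split.
- apply: (@within_if _ _ _ C1 C2 (fun p => H (2 * p.1 + 0, p.2))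
    (fun p => H' (2 * p.1 + (- 1), p.2))) => //.
  + by move=> [t x] _; rewrite /C1 /C2 /=; case: (leP t (1 / 2)); [left|right; apply: ltW].
  + apply: (within_comp (scale 2 0 _) _ cH) => -[t x] [[/= + Ax] C1t].
    by rewrite /C1 /= in_itv /= in C1t *; split => //; rewrite in_itv /=; lra.
  + apply: (within_comp (scale 2 (-1) _) _ cH') => -[t x] [[/= + Ax] C2t].
    by rewrite /C2 /= in_itv /= in C2t *; split => //; rewrite in_itv /=; lra.
  + move=> [t x] [/= _ Ax]; rewrite /C1 /C2 /= => t1 t2.
    have -> : t = 1 / 2 by lra.
    have -> : 2 * (1 / 2) + 0 = 1 :> R by lra.
    have -> : 2 * (1 / 2) + -1 = 0 :> R by lra.
    by rewrite H1 // H'0.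
- move=> x Ax; rewrite mem_set /C1 /=; last by lra.
  by rewrite mulr0 addr0 H0.
- move=> x Ax; rewrite memNset /C1 /=; last by lra.
  have -> : 2 * 1 + -1 = 1 :> R by lra.
  by rewrite H'1.
- by [].
Qed.

(** Straight-line homotopies, transported by a map [f] that is only defined
    on [P]. *)
Lemma homotopic_line {X Y : topologicalType} n (A : set X) (P : set 'rV[R]_n)
    (r0 r1 : X -> 'rV[R]_n) (f : 'rV[R]_n -> Y) :
  {within A, continuous r0} -> {within A, continuous r1} ->
  {within P, continuous f} ->
  (forall x t, A x -> 0 <= t <= 1 -> P ((1 - t) *: r0 x + t *: r1 x)) ->
  homotopic A (f \o r0) (f \o r1).
Proof.
move=> c0 c1 cf AP.
exists (fun p => f ((1 - p.1) *: r0 p.2 + p.1 *: r1 p.2)); split.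
- refine (within_comp (f := fun p : R * X => (1 - p.1) *: r0 p.2 + p.1 *: r1 p.2) _ _ cf).
    have csnd (r : X -> 'rV[R]_n) : {within A, continuous r} ->
        {within `[0, 1]%classic `*` A, continuous (fun p : R * X => r p.2)}.
      move=> cr; refine (within_comp (f := snd) _ _ cr); first exact: within_snd.
      by move=> [t x] [].
    apply: within_mx => i j; pose g (p : R * X) := (1 - p.1) * r0 p.2 i j + p.1 * r1 p.2 i j.
    apply: (@within_eq _ _ _ g); last by move=> p _; rewrite !mxE.
    apply: within_add; apply: within_mul; try exact: within_fst.
    + by apply: within_sub_fun; [exact: within_cst|exact: within_fst].
    + by apply: within_coord; apply: csnd.
    + by apply: within_coord; apply: csnd.
  by move=> [t x] [/=]; rewrite in_itv /= => t01 Ax; apply: AP.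
- by move=> x Ax /=; rewrite subr0 scale1r scale0r addr0.
- by move=> x Ax /=; rewrite subrr scale1r scale0r add0r.
- by [].
Qed.

Lemma nullhomotopic_pullback {X Y Z : topologicalType} (A : set X) (B : set Y)
    (r : X -> Y) (f : Y -> Z) :
  {within A, continuous r} -> (forall x, A x -> B (r x)) ->
  nullhomotopic B f -> nullhomotopic A (f \o r).
Proof.
by move=> cr AB [z0 h]; exists z0; apply: (homotopic_pullback cr AB h).
Qed.

Lemma nullhomotopic_sub {X Y : topologicalType} (A B : set X) (f : X -> Y) :
  A `<=` B -> nullhomotopic B f -> nullhomotopic A f.
Proof. by move=> AB [y0 h]; exists y0; apply: homotopic_sub h. Qed.

Lemma nullhomotopic_homotopic {X Y : topologicalType} (A : set X) (f g : X -> Y) :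
  homotopic A f g -> nullhomotopic A g -> nullhomotopic A f.
Proof. by move=> fg [y0 h]; exists y0; apply: homotopic_trans h. Qed.

Lemma nullhomotopic_to {X Y : topologicalType} (A : set X) (f : X -> Y) (y : Y) :
  paths_exist Y -> nullhomotopic A f -> homotopic A f (cst y).
Proof.
move=> pY [y0 h]; have [p [cp p0 p1]] := pY y0 y.
apply: homotopic_trans h _; exists (p \o fst); split => //.
by apply: within_comp cp; [exact: within_fst|case=> t x []].
Qed.

(** The null-homotopies of the pieces can be made to end at the same point,
    because the target is path-connected; they then glue, because the pieces are
    open and disjoint. *)
Lemma nullhomotopic_disjoint {X Y : topologicalType} (I : Type) (A : set X)
    (O : I -> set X) (f : X -> Y) :
  paths_exist Y -> [set: Y] !=set0 ->
  (forall i, open (O i)) ->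
  (forall i, nullhomotopic (A `&` O i) f) ->
  (forall i j x, A x -> O i x -> O j x -> i = j) ->
  nullhomotopic (A `&` \bigcup_i O i) f.
Proof.
move=> pY [y _] oO nO dO; exists y.
have {nO} /choice [H hH] := fun i => nullhomotopic_to y pY (nO i).
(* [G] follows the homotopy of the unique piece that contains the point. *)
have /choice [G hG] : forall p : R * X, exists z, forall i, A p.2 -> O i p.2 -> z = H i p.
  move=> p; have [[i [Ap Oi]]|no] := pselect (exists i, A p.2 /\ O i p.2).
    by exists (H i p) => j Ap' Oj; rewrite (dO i j p.2).
  by exists y => i Ap Oi; case: no; exists i.
exists G; split => //.
- apply: within_local => -[t x] [/= t01 [Ax [i _ Oi]]].
  exists (snd @^-1` O i); split => //.
    by apply: open_comp => // p _; apply: cvg_snd.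
  have [cH _ _ _] := hH i.
  apply: (@within_eq _ _ _ (H i)).
    by apply: continuous_subspaceW cH => -[s z] /= [[? [? _]] ?].
  by move=> [s z] /= [[? [? _]] ?]; rewrite (hG _ i).
- move=> x [Ax [i _ Oi]]; rewrite (hG _ i) //.
  by have [_ h _ _] := hH i; apply: h.
- move=> x [Ax [i _ Oi]]; rewrite (hG _ i) //.
  by have [_ _ h _] := hH i; apply: h.
Qed.

End Homotopy.

(** * Row vectors with the maximum norm *)

Section RowVectors.
Variable R : realType.

Lemma rV_norm_le n (x : 'rV[R]_n) a :
  0 <= a -> (`|x| <= a <-> forall i, `|x 0 i| <= a).
Proof.
move=> a0; rewrite {1}/Num.norm /= mx_normrE; split => [/bigmax_leP[_ h] i|h].
  exact: (h (0, i) isT).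
by apply/bigmax_leP; split=> // -[k i] _ /=; rewrite ord1.
Qed.

Lemma rV_coord_le n (x : 'rV[R]_n) i : `|x 0 i| <= `|x|.
Proof. exact: (rV_norm_le x (normr_ge0 x)).1. Qed.

Lemma rV_norm_attained n (x : 'rV[R]_n) : `|x| != 0 -> exists i, `|x 0 i| = `|x|.
Proof.
by case/mx_norm_neq0 => -[k i] /= e; exists i; rewrite -(ord1 k) -e.
Qed.

Definition row_cons n (t : R) (y : 'rV[R]_n) : 'rV[R]_n.+1 :=
  \row_k oapp (fun i => y 0 i) t (unlift ord0 k).

Definition row_tail n (w : 'rV[R]_n.+1) : 'rV[R]_n := \row_i w 0 (lift ord0 i).

Lemma row_cons0 n t (y : 'rV[R]_n) : row_cons t y 0 ord0 = t.
Proof. by rewrite mxE unlift_none. Qed.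

Lemma row_consS n t (y : 'rV[R]_n) i : row_cons t y 0 (lift ord0 i) = y 0 i.
Proof. by rewrite mxE liftK. Qed.

Lemma row_tailK n t (y : 'rV[R]_n) : row_tail (row_cons t y) = y.
Proof. by apply/rowP => i; rewrite mxE row_consS. Qed.

Lemma row_consK n (w : 'rV[R]_n.+1) : row_cons (w 0 ord0) (row_tail w) = w.
Proof.
apply/rowP => k; case: (unliftP ord0 k) => [i ->|->].
  by rewrite row_consS mxE.
by rewrite row_cons0.
Qed.

(** The cube [[0,1]^n] is the unit ball of the maximum norm, up to an affine
    change of coordinates.  Radial constructions are done in the ball. *)
Definition centered n (q : 'rV[R]_n) : 'rV[R]_n := \row_i (2 * q 0 i - 1).
Definition uncentered n (w : 'rV[R]_n) : 'rV[R]_n := \row_i ((w 0 i + 1) / 2).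

Lemma centeredK n : cancel (@centered n) (@uncentered n).
Proof. by move=> q; apply/rowP => i; rewrite !mxE; field. Qed.

Lemma uncenteredK n : cancel (@uncentered n) (@centered n).
Proof. by move=> q; apply/rowP => i; rewrite !mxE; field. Qed.

Lemma cube_uncentered n (w : 'rV[R]_n) : `|w| <= 1 -> cube (uncentered w).
Proof.
move=> /(rV_norm_le w ler01) h i; rewrite mxE.
by have := h i; rewrite ler_norml; lra.
Qed.

Lemma norm_centered n (q : 'rV[R]_n) : cube q -> `|centered q| <= 1.
Proof.
move=> h; apply/rV_norm_le => // i; rewrite mxE ler_norml.
by have := h i; lra.
Qed.

Lemma cube_boundary_uncentered n (w : 'rV[R]_n) :
  `|w| = 1 -> cube_boundary (uncentered w).
Proof.
move=> w1; split; first by apply: cube_uncentered; rewrite w1.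
have [i] : exists i, `|w 0 i| = `|w| by apply: rV_norm_attained; rewrite w1 oner_neq0.
rewrite w1 => wi; exists i; rewrite mxE; case: (lerP 0 (w 0 i)) => w0.
  by right; move: wi; rewrite ger0_norm // => ->; field.
by left; move: wi; rewrite ltr0_norm // => wi; lra.
Qed.

Lemma norm_cube_boundary n (q : 'rV[R]_n) : cube_boundary q -> `|centered q| = 1.
Proof.
case=> cq [i qi]; apply/eqP; rewrite eq_le norm_centered //=.
have := rV_coord_le (centered q) i; rewrite mxE.
by case: qi => ->; rewrite ?mulr0 ?mulr1 ?add0r ?normrN ?normr1 //;
   rewrite (_ : 2 - 1 = 1 :> R) ?normr1 //; lra.
Qed.

Lemma within_centered {X : topologicalType} n (A : set X) (f : X -> 'rV[R]_n) :
  {within A, continuous f} -> {within A, continuous (fun x => centered (f x))}.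
Proof.
move=> cf; apply: within_mx => k i.
apply: (@within_eq _ _ _ (fun x => 2 * f x 0 i - 1)) => [|x _]; last by rewrite !mxE.
apply: within_sub_fun; last exact: within_cst.
by apply: within_mul; [exact: within_cst|exact: within_coord].
Qed.

Lemma within_uncentered {X : topologicalType} n (A : set X) (f : X -> 'rV[R]_n) :
  {within A, continuous f} -> {within A, continuous (fun x => uncentered (f x))}.
Proof.
move=> cf; apply: within_mx => k i.
apply: (@within_eq _ _ _ (fun x => (f x 0 i + 1) / 2)) => [|x _]; last by rewrite !mxE.
apply: within_mul; last exact: within_cst.
by apply: within_add; [exact: within_coord|exact: within_cst].
Qed.

Lemma within_row_cons {X : topologicalType} n (A : set X) (t : X -> R) (f : X -> 'rV[R]_n) :
  {within A, continuous t} -> {within A, continuous f} ->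
  {within A, continuous (fun x => row_cons (t x) (f x))}.
Proof.
move=> ct cf; apply: within_mx => k i; rewrite (ord1 k); case: (unliftP ord0 i) => [l ->|->].
  apply: (@within_eq _ _ _ (fun x => f x 0 l)) => [|x _]; last by rewrite row_consS.
  exact: within_coord.
by apply: (@within_eq _ _ _ t) => [//|x _]; rewrite row_cons0.
Qed.

Lemma within_row_tail {X : topologicalType} n (A : set X) (f : X -> 'rV[R]_n.+1) :
  {within A, continuous f} -> {within A, continuous (fun x => row_tail (f x))}.
Proof.
move=> cf; apply: within_mx => k i.
apply: (@within_eq _ _ _ (fun x => f x 0 (lift ord0 i))) => [|x _]; last by rewrite !mxE.
exact: within_coord.
Qed.

Lemma within_scale {X : topologicalType} n (A : set X) (a : X -> R) (f : X -> 'rV[R]_n) :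
  {within A, continuous a} -> {within A, continuous f} ->
  {within A, continuous (fun x => a x *: f x)}.
Proof.
move=> ca cf; apply: within_mx => k i.
apply: (@within_eq _ _ _ (fun x => a x * f x k i)) => [|x _]; last by rewrite !mxE.
by apply: within_mul => //; apply: within_coord.
Qed.

Lemma within_addv {X : topologicalType} n (A : set X) (f g : X -> 'rV[R]_n) :
  {within A, continuous f} -> {within A, continuous g} ->
  {within A, continuous (fun x => f x + g x)}.
Proof.
move=> ca cf; apply: within_mx => k i.
apply: (@within_eq _ _ _ (fun x => f x k i + g x k i)) => [|x _]; last by rewrite !mxE.
by apply: within_add; apply: within_coord.
Qed.

Lemma within_norm {X : topologicalType} n (A : set X) (f : X -> 'rV[R]_n) :
  {within A, continuous f} -> {within A, continuous (fun x => `|f x|)}.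
Proof. by move=> cf; apply: (within_comp_continuous cf); apply: norm_continuous. Qed.

Lemma within_id {X : topologicalType} (A : set X) : {within A, continuous (fun x : X => x)}.
Proof. by apply: continuous_subspaceT => x; apply: cvg_id. Qed.

(** * Maps on the boundary of a cube *)

Section Collapse.
Variable j : nat.
Implicit Type w : 'rV[R]_j.+1.

(** The bottom of the unit ball is its face [w 0 ord0 = -1].  This parameter is
    the distance to the center on the bottom, and 1 on all other faces. *)
Definition collapse_param w : R := Num.max `|row_tail w| ((w 0 ord0 + 1) / 2).

(** Up to radial projection, a self-map of the unit sphere that sends all faces
    but the bottom to the apex [row_cons 1 0], and wraps the bottom around the
    sphere: its center is fixed, and its boundary goes to the apex. *)
Definition collapse w : 'rV[R]_j.+1 :=
  row_cons (2 * collapse_param w - 1) ((1 - collapse_param w) *: row_tail w).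

Lemma row_tail_le w : `|row_tail w| <= `|w|.
Proof. by apply/rV_norm_le => // i; rewrite mxE; apply: rV_coord_le. Qed.

Lemma collapse_param_bounds w : `|w| <= 1 -> 0 <= collapse_param w <= 1.
Proof.
move=> w1; rewrite /collapse_param le_max normr_ge0 /= ge_max.
rewrite (le_trans (row_tail_le w) w1) /=.
by have := le_trans (rV_coord_le w ord0) w1; rewrite ler_norml; lra.
Qed.

Lemma within_collapse {X : topologicalType} (A : set X) (f : X -> 'rV[R]_j.+1) :
  {within A, continuous f} -> {within A, continuous (fun x => collapse (f x))}.
Proof.
move=> cf; have ct := within_row_tail cf.
have ck : {within A, continuous (fun x => collapse_param (f x))}.
  apply: within_max; first exact: within_norm.
  apply: within_mul; last exact: within_cst.
  by apply: within_add; [exact: within_coord|exact: within_cst].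
apply: within_row_cons.
  apply: within_sub_fun; last exact: within_cst.
  by apply: within_mul => //; exact: within_cst.
by apply: within_scale => //; apply: within_sub_fun => //; exact: within_cst.
Qed.

Lemma collapse_apex w : collapse_param w = 1 -> collapse w = row_cons 1 0.
Proof.
by move=> k1; rewrite /collapse k1 subrr scale0r; congr row_cons; lra.
Qed.

(** [collapse] never points in the direction opposite to its argument, so that
    radial projection of segments is a homotopy from the identity to it. *)
Lemma collapse_segment_neq0 w s :
  `|w| = 1 -> 0 <= s <= 1 -> (1 - s) *: w + s *: collapse w != 0.
Proof.
move=> w1 s01; apply/eqP => e.
have k01 : 0 <= collapse_param w <= 1 by apply: collapse_param_bounds; rewrite w1.
have e0 : (1 - s) * w 0 ord0 + s * (2 * collapse_param w - 1) = 0.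
  by have /rowP /(_ ord0) := e; rewrite ![in X in X -> _]mxE unlift_none.
have eS i : (1 - s * collapse_param w) * w 0 (lift ord0 i) = 0.
  have /rowP /(_ (lift ord0 i)) := e; rewrite ![in X in X -> _]mxE liftK /= !mxE => <-.
  by ring.
have [t0|] := eqVneq (row_tail w) 0.
  have hk : collapse_param w = Num.max 0 ((w 0 ord0 + 1) / 2).
    by rewrite /collapse_param t0 normr0.
  have [i] : exists i, `|w 0 i| = `|w| by apply: rV_norm_attained; rewrite w1 oner_neq0.
  rewrite w1; case: (unliftP ord0 i) => [l ->|-> h].
    have /rowP /(_ l) := t0; rewrite !mxE => ->.
    by rewrite normr0 => /esym /eqP; rewrite oner_eq0.
  have [h1|h1] : w 0 ord0 = 1 \/ w 0 ord0 = -1.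
    move: h; case: (lerP 0 (w 0 ord0)) => w0; first by rewrite ger0_norm //; left.
    by rewrite ltr0_norm // => h; right; lra.
  - move: e0; rewrite hk h1 max_r; last by lra.
    by move=> e0; lra.
  - move: e0; rewrite hk h1 max_l; last by lra.
    by move=> e0; lra.
rewrite -normr_eq0 => /[dup] /rV_norm_attained [i <-].
rewrite mxE normr_eq0 => wi0.
have /eqP := eS i; rewrite mulf_eq0 (negPf wi0) orbF => /eqP sk.
have s1 : s = 1 by nra.
have k1 : collapse_param w = 1 by nra.
by move: e0; rewrite s1 k1; lra.
Qed.

End Collapse.
End RowVectors.

(** A map [g] from the sphere is homotopic, on an outer shell of the ball, to
    its composite with [collapse].  The latter is constant off the bottom face;
    on the bottom it is therefore a map of a [j]-cube with constant boundary
    values, whose null-homotopy fills the inner ball. *)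
Lemma extend_from_boundary (R : realType) (Y : topologicalType) j
    (g : 'rV[R]_j.+1 -> Y) :
  (forall y, @trivial_homotopy_set R Y j y) ->
  {within @cube_boundary R j.+1, continuous g} ->
  exists G : 'rV[R]_j.+1 -> Y, {within @cube R j.+1, continuous G} /\
    forall x, cube_boundary x -> G x = g x.
Proof.
move=> hY cg.
pose rad (w : 'rV[R]_j.+1) := g (uncentered (`|w|^-1 *: w)).
have norm_rad (w : 'rV[R]_j.+1) : w != 0 -> `|(`|w|^-1 *: w)| = 1.
  by move=> w0; rewrite normrZ normfV normr_id mulVf // normr_eq0.
have crad : {within [set w | w != 0], continuous rad}.
  apply: (within_comp (f := fun w => uncentered (`|w|^-1 *: w)) _ _ cg).
    apply: within_uncentered; apply: within_scale; last exact: within_id.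
    apply: within_inv; last by apply: within_norm; exact: within_id.
    by move=> w w0; rewrite normr_eq0.
  by move=> w w0; apply: cube_boundary_uncentered; apply: norm_rad.
pose bottom (q : 'rV[R]_j) : 'rV[R]_j.+1 := row_cons (-1) (centered q).
have bottom_norm q : cube q -> `|bottom q| = 1.
  move=> cq; apply/eqP; rewrite eq_le; apply/andP; split.
    apply/rV_norm_le => // k; case: (unliftP ord0 k) => [i ->|->].
      by rewrite row_consS (le_trans (rV_coord_le _ _)) // norm_centered.
    by rewrite row_cons0 normrN normr1.
  by have := rV_coord_le (bottom q) ord0; rewrite row_cons0 normrN normr1.
have collapse_neq0 (w : 'rV[R]_j.+1) : `|w| = 1 -> collapse w != 0.
  move=> w1; have := @collapse_segment_neq0 _ _ w 1 w1.
  by rewrite subrr scale0r add0r scale1r; apply; lra.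
have height_bottom q : cube q -> collapse_param (bottom q) = `|centered q|.
  by move=> cq; rewrite /collapse_param row_tailK row_cons0 addNr mul0r max_l.
pose y0 := rad (row_cons 1 0).
pose f0 q := rad (collapse (bottom q)).
have cf0 : {within @cube R j, continuous f0}.
  apply: (within_comp (f := fun q => collapse (bottom q)) _ _ crad).
    apply: within_collapse; apply: within_row_cons; first exact: within_cst.
    by apply: within_centered; exact: within_id.
  by move=> q cq; apply/collapse_neq0/bottom_norm.
have f0b q : cube_boundary q -> f0 q = y0.
  move=> bq; rewrite /f0 collapse_apex // height_bottom; first exact: norm_cube_boundary.
  by case: bq.
have [H [cH H0 H1 Hb]] := hY y0 f0 cf0 f0b.
(* The two halves of the extension, which agree where the norm is 1/2; the
   time of the homotopy on the shell is [2 - 2 * `|w|]. *)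
pose core (w : 'rV[R]_j.+1) := H ((2 * w 0 ord0 + 1) / 2, uncentered (2 *: row_tail w)).
pose shell (w : 'rV[R]_j.+1) := rad ((1 - (2 - 2 * `|w|)) *: (`|w|^-1 *: w) +
  (2 - 2 * `|w|) *: collapse (`|w|^-1 *: w)).
have core_shell (w : 'rV[R]_j.+1) : `|w| = 1 / 2 -> shell w = core w.
  move=> w2; rewrite /shell /core w2.
  have -> : 2 - 2 * (1 / 2) = 1 :> R by field.
  rewrite subrr scale0r add0r scale1r div1r invrK.
  have v1 : `|2 *: w| = 1 by rewrite normrZ w2 ger0_norm //; field.
  have v1le : `|2 *: w| <= 1 by rewrite v1.
  have [i] : exists i, `|(2 *: w) 0 i| = `|2 *: w|.
    by apply: rV_norm_attained; rewrite v1 oner_neq0.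
  rewrite v1 [in X in X -> _]mxE.
  have tailE : row_tail (2 *: w) = 2 *: row_tail w.
    by apply/rowP => l; rewrite !mxE.
  have tail1 : `|2 *: row_tail w| <= 1 by rewrite -tailE (le_trans (row_tail_le _)) // v1.
  have cu : cube (uncentered (2 *: row_tail w)) by apply: cube_uncentered.
  have t01 : 0 <= (2 * w 0 ord0 + 1) / 2 <= 1.
    have := rV_coord_le (2 *: w) ord0.
    by rewrite v1 mxE ler_norml; lra.
  (* [2 *: w] lies on a side face, on the top face, or on the bottom face. *)
  case: (unliftP ord0 i) => [l ->|->] hl.
    have tn : `|row_tail (2 *: w)| = 1.
      apply/eqP; rewrite eq_le tailE tail1 -tailE /=.
      by have := rV_coord_le (row_tail (2 *: w)) l; rewrite !mxE hl.
    rewrite Hb //.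
    + rewrite f0b; last by apply: cube_boundary_uncentered; rewrite -tailE.
      rewrite collapse_apex //; apply/eqP; rewrite eq_le.
      have /andP[_ ->] /= := collapse_param_bounds v1le.
      by rewrite /collapse_param le_max tn lexx.
    + by apply: cube_boundary_uncentered; rewrite -tailE.
  have [h1|h1] : 2 * w 0 ord0 = 1 \/ 2 * w 0 ord0 = -1.
    move: hl; case: (lerP 0 (2 * w 0 ord0)) => w0; first by rewrite ger0_norm //; left.
    by rewrite ltr0_norm // => h; right; lra.
  - rewrite h1 (_ : (1 + 1) / 2 = 1 :> R); last by field.
    rewrite H1 // collapse_apex //; apply/eqP; rewrite eq_le.
    have /andP[_ ->] /= := collapse_param_bounds v1le.
    by rewrite /collapse_param le_max mxE h1 (_ : (1 + 1) / 2 = 1 :> R) ?lexx ?orbT //; field.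
  - rewrite h1 (_ : (-1 + 1) / 2 = 0 :> R); last by field.
    rewrite H0 // /f0 /bottom uncenteredK -tailE -h1.
    by rewrite (_ : 2 * w 0 ord0 = (2 *: w) 0 ord0) ?row_consK // mxE.
pose C1 := [set w : 'rV[R]_j.+1 | 1 / 2 <= `|w|].
pose C2 := [set w : 'rV[R]_j.+1 | `|w| <= 1 / 2].
have cnorm : continuous (fun w : 'rV[R]_j.+1 => `|w|) by apply: norm_continuous.
have cl1 : closed C1.
  by apply: (@preimage_closed _ _ (fun w : 'rV[R]_j.+1 => `|w|) [set t : R | 1 / 2 <= t]) => //;
    exact: closed_ge.
have cl2 : closed C2.
  by apply: (@preimage_closed _ _ (fun w : 'rV[R]_j.+1 => `|w|) [set t : R | t <= 1 / 2]) => //;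
    exact: closed_le.
pose G w := if w \in C1 then shell w else core w.
have cG : {within [set w | `|w| <= 1], continuous G}.
  apply: (@within_if _ _ _ C1 C2 shell core) => //.
  - by move=> w _; rewrite /C1 /C2 /=; case: (leP (1 / 2) `|w|); [left|right; apply: ltW].
  - have cu : {within [set w : 'rV[R]_j.+1 | `|w| <= 1] `&` C1,
        continuous (fun w => `|w|^-1 *: w)}.
      apply: within_scale; last exact: within_id.
      apply: within_inv; last by apply: within_norm; exact: within_id.
      by move=> w [_]; rewrite /C1 /= => w2; apply/eqP => w0; move: w2; rewrite w0; lra.
    have cs : {within [set w : 'rV[R]_j.+1 | `|w| <= 1] `&` C1,
        continuous (fun w => 2 - 2 * `|w|)}.
      apply: within_sub_fun; first exact: within_cst.
      apply: within_mul; first exact: within_cst.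
      by apply: within_norm; exact: within_id.
    apply: (within_comp (f := fun w : 'rV[R]_j.+1 => (1 - (2 - 2 * `|w|)) *: (`|w|^-1 *: w) +
      (2 - 2 * `|w|) *: collapse (`|w|^-1 *: w)) _ _ crad).
      apply: within_addv; apply: within_scale => //; last exact: within_collapse.
      by apply: within_sub_fun => //; exact: within_cst.
    move=> w [/= w1]; rewrite /C1 /= => w2; apply: collapse_segment_neq0; last by lra.
    by apply: norm_rad; apply/eqP => w0; move: w2; rewrite w0 normr0; lra.
  - apply: (within_comp (f := fun w : 'rV[R]_j.+1 =>
      ((2 * w 0 ord0 + 1) / 2, uncentered (2 *: row_tail w))) _ _ cH).
      apply: within_pair.
        apply: within_mul; last exact: within_cst.
        apply: within_add; last exact: within_cst.
        by apply: within_mul; [exact: within_cst|apply: within_coord; exact: within_id].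
      apply: within_uncentered; apply: within_scale; first exact: within_cst.
      by apply: within_row_tail; exact: within_id.
    move=> w [/= w1]; rewrite /C2 /= => w2; split => /=.
      by rewrite in_itv /=; have := le_trans (rV_coord_le w ord0) w2; rewrite ler_norml; lra.
    apply: cube_uncentered; rewrite normrZ ger0_norm //.
    by have := le_trans (row_tail_le w) w2; lra.
  - by move=> w _ h1 h2; apply: core_shell; apply/eqP; rewrite eq_le; apply/andP.
exists (G \o @centered R _); split.
  apply: (within_comp (f := @centered R _) _ _ cG).
    by apply: within_centered; exact: within_id.
  by move=> q /norm_centered.
move=> q bq; have n1 := norm_cube_boundary bq.
rewrite /G /= mem_set; last by rewrite /C1 /= n1; lra.
rewrite /shell n1 mulr1 subrr subr0 scale0r addr0 invr1 !scale1r.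
by rewrite /rad n1 invr1 scale1r centeredK.
Qed.

Lemma extend_over_cube (R : realType) (Y : topologicalType) m
    (g : 'rV[R]_m -> Y) :
  [set: Y] !=set0 ->
  (forall i y, (i < m)%N -> @trivial_homotopy_set R Y i y) ->
  {within @cube_boundary R m, continuous g} ->
  exists G : 'rV[R]_m -> Y, {within @cube R m, continuous G} /\
    forall x, cube_boundary x -> G x = g x.
Proof.
move=> [y _]; case: m g => [|j] g hY cg.
  by exists (cst y); split; [exact: within_cst|move=> x [_ [[]]]].
by apply: extend_from_boundary => // z; apply: hY.
Qed.

(** * The skeleton of a realization *)

Definition support (R : realType) n (x : 'rV[R]_n) : {set 'I_n} :=
  [set i | x 0 i != 0]%SET.

(** Simplicial complexes that may lack some of the vertices, such as skeleta. *)
Definition face_closed (V : finType) (K : {set {set V}}) :=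
  forall s t : {set V}, s \in K -> t \subset s -> t \in K.

Section Cone.
Variables (R : realType) (n : nat).
Implicit Types (s t : {set 'I_n}) (K L : {set {set 'I_n}}) (z : 'rV[R]_n).

Lemma supportP z s : reflect (forall i, i \notin s -> z 0 i = 0) (support z \subset s).
Proof.
apply: (iffP fintype.subsetP) => h i.
  by move=> nis; apply/eqP; apply: contraNT nis => zi; apply: h; rewrite inE.
by rewrite inE; apply: contraNT => /h ->.
Qed.

Definition cube_face s : set 'rV[R]_n := [set z | cube z /\ support z \subset s].
(** The cone over the realization of [K], with apex 0, subdivided into cubes.
    Its base [cone_base K] is the realization of [K] after radial projection. *)
Definition cubical_cone K : set 'rV[R]_n := [set z | cube z /\ support z \in K].
Definition cone_base K : set 'rV[R]_n := [set z | cubical_cone K z /\ `|z| = 1].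

Lemma closed_coord_preimage i (D : set R) : closed D -> closed [set z : 'rV[R]_n | D (z 0 i)].
Proof.
move=> cD; apply: (@preimage_closed _ _ (fun z : 'rV[R]_n => z 0 i) D) => // z _.
exact: coord_continuous.
Qed.

Lemma closed_cube_face s : closed (cube_face s).
Proof.
have -> : cube_face s = \bigcap_i ([set z : 'rV[R]_n | 0 <= z 0 i] `&` [set z | z 0 i <= 1] `&`
    (if i \in s then setT else [set z : 'rV[R]_n | [set 0 : R] (z 0 i)])).
  apply/seteqP; split => z.
    move=> [cz /supportP sz] i _; have /andP[? ?] := cz i; split => //.
    by case: ifPn => // /sz.
  move=> h; split; first by move=> i; have [[/= -> ->]] := h i I.
  by apply/supportP => i nis; have [_] := h i I; rewrite (negPf nis).
apply: closed_bigI => i _; apply: closedI.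
  apply: closedI.
    by apply: (@closed_coord_preimage i [set t | 0 <= t]); exact: closed_ge.
  by apply: (@closed_coord_preimage i [set t | t <= 1]); exact: closed_le.
case: ifP => _; first exact: closedT.
by apply: (@closed_coord_preimage i [set 0]); exact: closed_eq.
Qed.

Lemma closed_cubical_cone K : face_closed K -> closed (cubical_cone K).
Proof.
move=> fK; have -> : cubical_cone K = \big[setU/set0]_(s <- enum K) cube_face s.
  rewrite -bigcup_seq; apply/seteqP; split => z.
    by move=> [cz sz]; exists (support z); rewrite /= ?mem_enum.
  by move=> [s /=]; rewrite mem_enum => sK [cz sz]; split => //; apply: fK sz.
by apply: closed_bigsetU => s _; apply: closed_cube_face.
Qed.

Lemma closed_cone_base K : face_closed K -> closed (cone_base K).
Proof.
move=> fK; apply: closedI; first exact: closed_cubical_cone.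
apply: (@preimage_closed _ _ (fun z : 'rV[R]_n => `|z|) [set 1 : R]); last exact: closed_eq.
by move=> z _; apply: norm_continuous.
Qed.

(** A face of the big cube is a cube of dimension [#|s|].  The hypothesis on [D]
    says that [F] is already defined exactly on its boundary. *)
Lemma extend_over_face (Y : topologicalType) s (D : set 'rV[R]_n) (F : 'rV[R]_n -> Y) :
  [set: Y] !=set0 ->
  (forall i y, (i < #|s|)%N -> @trivial_homotopy_set R Y i y) ->
  {within D, continuous F} ->
  (forall z, cube_face s z ->
     (exists2 i, i \in s & z 0 i = 0 \/ z 0 i = 1) <-> D z) ->
  exists G : 'rV[R]_n -> Y, {within cube_face s, continuous G} /\
    forall z, cube_face s z -> D z -> G z = F z.
Proof.
move=> Y0 hY cF bD.
pose e (k : 'I_#|s|) : 'I_n := enum_val k.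
have es k : e k \in s by apply: enum_valP.
have e_inj : injective e by apply: enum_val_inj.
have eP i : i \in s -> exists k, i = e k.
  by move=> si; exists (enum_rank_in si i); rewrite /e enum_rankK_in.
pose emb (q : 'rV[R]_#|s|) : 'rV[R]_n := \row_i \sum_(k | e k == i) q 0 k.
pose proj (z : 'rV[R]_n) : 'rV[R]_#|s| := \row_k z 0 (e k).
have embE q k : emb q 0 (e k) = q 0 k.
  rewrite mxE (bigD1 k) //= big1 ?addr0 // => l /andP[/eqP /e_inj ->].
  by rewrite eqxx.
have embN q i : i \notin s -> emb q 0 i = 0.
  by move=> nis; rewrite mxE big1 // => k /eqP ki; rewrite -ki es in nis.
have projK z : support z \subset s -> emb (proj z) = z.
  move=> /supportP sz; apply/rowP => i; have [/eP[k ->]|nis] := boolP (i \in s).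
    by rewrite embE mxE.
  by rewrite embN // sz.
have emb_face q : cube q -> cube_face s (emb q).
  move=> cq; split; last by apply/supportP => i /embN.
  move=> i; have [/eP[k ->]|nis] := boolP (i \in s); first by rewrite embE.
  by rewrite embN // lexx ler01.
have [|G [cG GF]] := @extend_over_cube R Y #|s| (F \o emb) Y0 hY.
  apply: (within_comp (f := emb) _ _ cF).
    apply: within_mx => k i.
    apply: (@within_eq _ _ _ (fun q : 'rV[R]_#|s| => \sum_(k | e k == i) q 0 k)) => [|q _].
      by apply: within_sum => l _; apply: within_coord; exact: within_id.
    by rewrite mxE.
  move=> q [cq [k qk]]; apply/(bD _ (emb_face _ cq)).
  by exists (e k); rewrite ?embE.
exists (G \o proj); split.
  apply: (within_comp (f := proj) _ _ cG).
    apply: within_mx => k i.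
    apply: (@within_eq _ _ _ (fun z : 'rV[R]_n => z 0 (e i))) => [|z _]; last by rewrite mxE.
    by apply: within_coord; exact: within_id.
  by move=> z [cz _] k; rewrite mxE.
move=> z fz /(bD _ fz) [i /eP[k ->] zk]; rewrite /= GF /= ?projK //; first by case: fz.
by split; [move=> l; rewrite mxE; case: fz => + _; apply|exists k; rewrite mxE].
Qed.

(** Induction on the set of cubes over which the map has been extended.  A cube
    of maximal dimension is added last: its faces in direction 0 are smaller
    cubes, and its faces in direction 1 belong to the base. *)
Lemma extend_over_cone (Y : topologicalType) K (f : 'rV[R]_n -> Y) :
  [set: Y] !=set0 -> face_closed K ->
  (forall s i y, s \in K -> (i < #|s|)%N -> @trivial_homotopy_set R Y i y) ->
  {within cone_base K, continuous f} ->
  exists F : 'rV[R]_n -> Y, {within cubical_cone K, continuous F} /\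
    forall z, cone_base K z -> F z = f z.
Proof.
move=> Y0 fK hY cf.
suff [F [cF Ff]] : exists F : 'rV[R]_n -> Y,
    {within cone_base K `|` cubical_cone K, continuous F} /\
    forall z, cone_base K z -> F z = f z.
  by exists F; split => //; apply: continuous_subspaceW cF => z; right.
have gen m : forall L, #|L| = m -> face_closed L -> L \subset K ->
    exists F : 'rV[R]_n -> Y, {within cone_base K `|` cubical_cone L, continuous F} /\
    forall z, cone_base K z -> F z = f z; last exact: (gen _ K).
elim: m => [|m IH] L cL fL LK.
  exists f; split => //; apply: continuous_subspaceW cf => z [//|[_]].
  by rewrite (cards0_eq cL) inE.
have [s0 s0L] : exists s0, s0 \in L by apply/set0Pn; rewrite -card_gt0 cL.
pose s := [arg max_(s > s0 in L) #|s|].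
have [sL smax] : s \in L /\ forall t, t \in L -> (#|t| <= #|s|)%N.
  by rewrite /s; case: arg_maxnP.
pose L' := L :\ s.
have fL' : face_closed L'.
  move=> t u; rewrite !inE => /andP[ts tL] ut; rewrite (fL _ _ tL ut) andbT.
  apply: contraNneq ts => us; rewrite eq_sym eqEcard.
  by rewrite -{1}us ut smax.
have L'K : L' \subset K by apply: fintype.subset_trans LK; apply: subsetDl.
have [|F [cF Ff]] := IH L' _ fL' L'K.
  by have := cardsD1 s L; rewrite cL sL add1n => -[].
have sK : s \in K by apply: (fintype.subsetP LK).
pose D := cone_base K `|` cubical_cone L'.
have clD : closed D by apply: closedU; [exact: closed_cone_base|exact: closed_cubical_cone].
have bD z : cube_face s z ->
    (exists2 i, i \in s & z 0 i = 0 \/ z 0 i = 1) <-> D z.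
  move=> [cz sz]; split.
    move=> [i si [zi|zi]].
      right; split => //; rewrite !inE (fL _ _ sL sz) andbT.
      apply: contraTneq si => <-; by rewrite inE zi eqxx.
    left; split; first by split => //; apply: fK sz.
    apply/eqP; rewrite eq_le; apply/andP; split.
      by apply/rV_norm_le => // l; have := cz l; rewrite ler_norml; lra.
    by have := rV_coord_le z i; rewrite zi normr1.
  move=> [[_ z1]|[_]].
    have [i] : exists i, `|z 0 i| = `|z| by apply: rV_norm_attained; rewrite z1 oner_neq0.
    have /andP[zi0 _] := cz i; rewrite ger0_norm // z1 => zi.
    by exists i; [apply: (fintype.subsetP sz); rewrite inE zi oner_neq0|right].
  rewrite !inE => /andP[zs _].
  have /properP[_ [i si]] : support z \proper s by rewrite finset.properEneq zs.
  by rewrite inE negbK => /eqP zi; exists i => //; left.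
have [G [cG GF]] := extend_over_face Y0 (fun i y => hY s i y sK) cF bD.
exists (fun z => if z \in cube_face s then G z else F z); split.
  have sub : cone_base K `|` cubical_cone L `<=` cube_face s `|` D.
    move=> z [bz|[cz sz]]; first by right; left.
    have [zs|zs] := eqVneq (support z) s; first by left; split => //; rewrite zs.
    by right; right; split => //; rewrite !inE zs.
  apply: (@within_if _ _ _ (cube_face s) D G F) => //.
  - exact: closed_cube_face.
  - by apply: continuous_subspaceW cG => z [].
  - by apply: continuous_subspaceW cF => z [].
  - by move=> z _; exact: GF.
move=> z bz; case: ifPn => [/set_mem fz|_]; last exact: Ff.
by rewrite GF ?Ff //; left.
Qed.

End Cone.

Section Skeleton.
Variables (R : realType) (n : nat) (Y : topologicalType).
Variables (K : {set {set 'I_n}}) (f : 'rV[R]_n -> Y).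
Hypothesis fK : face_closed K.
Hypothesis cf : {within @realization R n K, continuous f}.

Lemma realization_ge0 (L : {set {set 'I_n}}) (x : 'rV[R]_n) i : realization L x -> 0 <= x 0 i.
Proof. by case. Qed.

Lemma realization_neq0 (L : {set {set 'I_n}}) (x : 'rV[R]_n) : realization L x -> x != 0.
Proof.
case=> _ s1 _; apply/eqP => x0; move: s1; rewrite x0.
by under eq_bigr do rewrite mxE; rewrite big1 // => /esym /eqP; rewrite oner_eq0.
Qed.

Lemma support_scale a (x : 'rV[R]_n) : a != 0 -> support (a *: x) = support x.
Proof. by move=> a0; apply/setP => i; rewrite !inE mxE mulf_eq0 negb_or a0. Qed.

Lemma normalize_realization (L : {set {set 'I_n}}) (z : 'rV[R]_n) :
  (forall i, 0 <= z 0 i) -> \sum_i z 0 i != 0 -> support z \in L ->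
  realization L ((\sum_i z 0 i)^-1 *: z).
Proof.
move=> z0 s0 zL; split.
- by move=> i; rewrite mxE mulr_ge0 // invr_ge0 sumr_ge0.
- by under eq_bigr do rewrite mxE; rewrite -mulr_sumr mulVf.
- by rewrite -/(support _) support_scale // invr_eq0.
Qed.

Lemma within_coord_sum {X : topologicalType} (A : set X) (r : X -> 'rV[R]_n) :
  {within A, continuous r} -> {within A, continuous (fun x => \sum_i r x 0 i)}.
Proof. by move=> cr; apply: within_sum => i _; apply: within_coord. Qed.

Lemma within_normalize {X : topologicalType} (A : set X) (r : X -> 'rV[R]_n) :
  (forall x, A x -> \sum_i r x 0 i != 0) ->
  {within A, continuous r} ->
  {within A, continuous (fun x => (\sum_i r x 0 i)^-1 *: r x)}.
Proof.
move=> r0 cr; apply: within_scale => //; apply: within_inv => //.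
exact: within_coord_sum.
Qed.

(** Once extended over the cone, the map is contracted along the rays to the
    apex. *)
Lemma skeleton_nullhomotopic c :
  [set: Y] !=set0 ->
  (forall i y, (i <= c)%N -> @trivial_homotopy_set R Y i y) ->
  @nullhomotopic R _ _ (@realization R n K `&` [set x | (#|support x| <= c.+1)%N]) f.
Proof.
move=> Y0 hY; pose L := [set s in K | (#|s| <= c.+1)%N].
have fL : face_closed L.
  move=> s t; rewrite !inE => /andP[sK sc] ts; rewrite (fK sK ts).
  exact: leq_trans (subset_leq_card ts) sc.
pose g (z : 'rV[R]_n) := f ((\sum_i z 0 i)^-1 *: z).
have base_sum z : cone_base L z -> \sum_i z 0 i != 0.
  move=> [[cz _] z1]; have z0 i : 0 <= z 0 i by case/andP: (cz i).
  rewrite psumr_neq0; last by move=> i _.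
  have [i] : exists i, `|z 0 i| = `|z| by apply: rV_norm_attained; rewrite z1 oner_neq0.
  rewrite z1 ger0_norm // => zi; apply/hasP; exists i; rewrite ?mem_index_enum //=.
  by rewrite zi ltr01.
have cg : {within cone_base L, continuous g}.
  apply: (within_comp (f := fun z : 'rV[R]_n => (\sum_i z 0 i)^-1 *: z) _ _ cf).
    by apply: within_normalize; [exact: base_sum|exact: within_id].
  move=> z bz; apply: normalize_realization; last 1 first.
  - by case: bz => -[_]; rewrite inE => /andP[].
  - by move=> i; case: bz => -[/(_ i) /andP[]].
  - exact: base_sum.
have [|F [cF Fg]] := extend_over_cone Y0 fL _ cg.
  move=> s i y; rewrite inE => /andP[_ sc] si; apply: hY.
  by rewrite -ltnS (leq_trans si).
exists (F 0); exists (fun p => F ((1 - p.1) *: (`|p.2|^-1 *: p.2))); split.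
- apply: (within_comp (f := fun p : R * 'rV[R]_n => (1 - p.1) *: (`|p.2|^-1 *: p.2)) _ _ cF).
    apply: within_scale.
      by apply: within_sub_fun; [exact: within_cst|exact: within_fst].
    apply: within_scale; last exact: within_snd.
    apply: within_inv; last by apply: within_norm; exact: within_snd.
    by move=> [t x] [_ [/realization_neq0]]; rewrite /= normr_eq0.
  move=> [t x] [/= + [rx cx]]; rewrite in_itv /= => t01.
  have x0 := realization_neq0 rx.
  split.
    move=> i; rewrite !mxE; have h := realization_ge0 i rx.
    have h1 : 0 <= `|x|^-1 * x 0 i <= 1.
      rewrite mulr_ge0 ?invr_ge0 //= mulrC ler_pdivrMr ?normr_gt0 // mul1r.
      by rewrite -[leLHS]ger0_norm // rV_coord_le.
    by nra.
  apply: (fL (support x)); first by rewrite inE; case: rx => _ _ ->.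
  by apply/supportP => i; rewrite inE negbK !mxE => /eqP ->; rewrite !mulr0.
- move=> x [rx cx] /=; rewrite subr0 scale1r.
  have x0 := realization_neq0 rx.
  rewrite Fg.
    rewrite /g; congr f; rewrite scalerA.
    under eq_bigr do rewrite mxE; rewrite -mulr_sumr.
    case: rx => _ -> _; rewrite mulr1 invrK mulfV ?scale1r //.
    by rewrite normr_eq0.
  have nx : `|(`|x|^-1 *: x)| = 1 by rewrite normrZ normfV normr_id mulVf // normr_eq0.
  split => //; split.
    move=> i; apply/andP; split.
      by rewrite mxE mulr_ge0 ?invr_ge0 ?(realization_ge0 i rx).
    by rewrite (le_trans (ler_norm _)) // -nx rV_coord_le.
  rewrite support_scale ?invr_eq0 ?normr_eq0 // inE cx andbT.
  by case: rx.
- by move=> x _ /=; rewrite subrr scale0r.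
- by [].
Qed.

End Skeleton.

(** * Null-homotopic coverings *)

Lemma trivial_pi0_paths (R : realType) (Y : topologicalType) :
  (forall y, @trivial_homotopy_set R Y 0 y) -> paths_exist R Y.
Proof.
move=> hY a b; have [||H [cH H0 H1 _]] := hY b (cst a).
- exact: within_cst.
- by move=> x [_ [[]]].
have c0 : @cube R 0 0 by case.
exists (fun t => H (t, 0)); split; rewrite ?H0 ?H1 //.
apply: (within_comp (f := fun t : R => (t, 0 : 'rV[R]_0)) _ _ cH).
  by apply: within_pair; [exact: within_id|exact: within_cst].
by move=> t t01; split.
Qed.

Lemma nullhomotopic_empty (R : realType) (X Y : topologicalType) (A : set X) (f : X -> Y) :
  [set: Y] !=set0 -> (forall x, ~ A x) -> @nullhomotopic R _ _ A f.
Proof.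
move=> [y _] A0; exists y, (cst y); split => //; first exact: within_cst.
by move=> x /A0.
Qed.

Lemma subset_of_card (V : finType) (T : {set V}) k :
  (k <= #|T|)%N -> exists2 s : {set V}, s \subset T & #|s| = k.
Proof.
move=> kT; exists [set x in take k (enum T)].
  by apply/fintype.subsetP => x; rewrite inE => /mem_take; rewrite mem_enum.
rewrite cardsE (card_uniqP _) ?size_takel -?cardE //.
by rewrite take_uniq // enum_uniq.
Qed.

Section Covers.
Variables (R : realType) (n : nat) (Y : topologicalType).
Variables (K : {set {set 'I_n}}) (f : 'rV[R]_n -> Y).
Hypothesis fK : face_closed K.
Hypothesis cf : {within @realization R n K, continuous f}.
Hypothesis Y0 : [set: Y] !=set0.

Local Notation "'|K|'" := (@realization R n K).
Local Notation null A := (@nullhomotopic R _ _ (|K| `&` A) f).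

Lemma segment_realization (x y : 'rV[R]_n) s (t : R) :
  |K| x -> |K| y -> s \in K -> support x \subset s -> support y \subset s ->
  0 <= t <= 1 -> |K| ((1 - t) *: x + t *: y).
Proof.
move=> [x0 x1 _] [y0 y1 _] sK /supportP xs /supportP ys t01; split.
- by move=> i; rewrite !mxE addr_ge0 // mulr_ge0 //; lra.
- under eq_bigr do rewrite !mxE.
  by rewrite big_split /= -!mulr_sumr x1 y1; ring.
- apply: (fK sK); apply/supportP => i nis.
  by rewrite !mxE xs // ys // !mulr0 addr0.
Qed.

(** Two maps into the realization that send each point into a common simplex
    are homotopic along segments. *)
Lemma carrier_homotopic (A : set 'rV[R]_n) (r0 r1 : 'rV[R]_n -> 'rV[R]_n) :
  {within A, continuous r0} -> {within A, continuous r1} ->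
  (forall x, A x -> [/\ |K| (r0 x), |K| (r1 x) &
    exists2 s, s \in K & support (r0 x) \subset s /\ support (r1 x) \subset s]) ->
  @homotopic_rel R _ _ A set0 (f \o r0) (f \o r1).
Proof.
move=> c0 c1 h; apply: (homotopic_line c0 c1 cf) => x t Ax t01.
have [k0 k1 [s sK [s0 s1]]] := h x Ax.
exact: segment_realization s0 s1 t01.
Qed.

Definition open_star (s : {set 'I_n}) : set 'rV[R]_n :=
  [set x | exists2 i, i \in s & x 0 i != 0].

Lemma coord_gt0_open i : open [set x : 'rV[R]_n | 0 < x 0 i].
Proof.
apply: (@open_comp _ _ (fun x : 'rV[R]_n => x 0 i) [set t | 0 < t]); last exact: open_gt.
by move=> z _; apply: coord_continuous.
Qed.

Lemma coord_lt_open l i : open [set x : 'rV[R]_n | x 0 l < x 0 i].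
Proof.
have -> : [set x : 'rV[R]_n | x 0 l < x 0 i] =
    (fun x : 'rV[R]_n => x 0 i - x 0 l) @^-1` [set t | 0 < t].
  by apply/seteqP; split => x; rewrite /= subr_gt0.
apply: open_comp; last exact: open_gt.
by move=> z _; apply: (@continuousB R); apply: coord_continuous.
Qed.

Lemma open_open_star s : open (open_star s).
Proof.
have -> : open_star s = \bigcup_(i in [set i | i \in s]) [set x : 'rV[R]_n | x 0 i != 0].
  by apply/seteqP; split => x [i /= ? ?]; exists i.
apply: bigcup_open => i _.
apply: (@open_comp _ _ (fun x : 'rV[R]_n => x 0 i) [set t | t != 0]); last exact: open_neq.
by move=> z _; apply: coord_continuous.
Qed.

(** Dropping the coordinates outside [s] and normalizing retracts the star to
    the simplex [s], which is then contracted to a vertex. *)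
Lemma open_star_nullhomotopic s : s \in K -> null (open_star s).
Proof.
move=> sK; have [s0|[i0 i0s]] := set_0Vmem s.
  apply: nullhomotopic_empty => // x [_ [i]].
  by rewrite s0 inE.
pose v : 'rV[R]_n := delta_mx 0 i0.
have sv : support v \subset s.
  by apply/supportP => i; rewrite !mxE eqxx /=; case: eqVneq => // ->; rewrite i0s.
have vK : |K| v.
  split; last exact: fK sv.
    by move=> i; rewrite mxE ler0n.
  rewrite (bigD1 i0) //= big1 ?mxE ?eqxx ?addr0 // => i /negPf ii0.
  by rewrite mxE ii0 andbF.
pose r (x : 'rV[R]_n) : 'rV[R]_n := \row_i (if i \in s then x 0 i else 0).
have r0 x i : |K| x -> 0 <= r x 0 i by case=> h _ _; rewrite mxE; case: ifP.
have rn x : (|K| `&` open_star s) x -> \sum_i r x 0 i != 0.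
  move=> [Kx [i si xi]]; rewrite psumr_neq0; last by move=> l _; apply: r0.
  apply/hasP; exists i; rewrite ?mem_index_enum //= mxE si lt_neqAle eq_sym xi.
  by case: Kx => -> _.
have sr x : support (r x) \subset support x :&: s.
  apply/supportP => i; rewrite !inE negb_and negbK mxE => h.
  by case: ifP h => // _; rewrite orbF => /eqP.
have srn x : support ((\sum_i r x 0 i)^-1 *: r x) \subset support x :&: s.
  apply: fintype.subset_trans (sr x); apply/supportP => i.
  by rewrite inE negbK => /eqP ri; rewrite mxE ri mulr0.
have cr : {within |K| `&` open_star s, continuous (fun x => (\sum_i r x 0 i)^-1 *: r x)}.
  apply: within_normalize; first exact: rn.
  apply: within_mx => k i.
  apply: (@within_eq _ _ _ (fun x : 'rV[R]_n => if i \in s then x 0 i else 0)) => [|x _];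
    last by rewrite mxE.
  by case: (i \in s); [apply: within_coord; exact: within_id|exact: within_cst].
have rK x : (|K| `&` open_star s) x -> |K| ((\sum_i r x 0 i)^-1 *: r x).
  move=> Ax; apply: normalize_realization; last 1 first.
  - by apply: (fK sK); apply: fintype.subset_trans (sr x) _; apply: subsetIr.
  - by move=> i; case: Ax => Kx _; apply: r0.
  - exact: rn.
apply: (nullhomotopic_homotopic (g := f \o (fun x => (\sum_i r x 0 i)^-1 *: r x))).
  apply: (@carrier_homotopic _ id) => //; first exact: within_id.
  move=> x Ax; split; [by case: Ax|exact: rK|].
  exists (support x); first by case: Ax => -[].
  by split => //; apply: fintype.subset_trans (srn x) _; apply: subsetIl.
exists (f v); apply: (@carrier_homotopic _ _ (cst v)) => //; first exact: within_cst.
move=> x Ax; split => //; first exact: rK.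
exists s => //; split => //.
by apply: fintype.subset_trans (srn x) _; apply: subsetIr.
Qed.

Definition null_coverable (k : nat) (A : set 'rV[R]_n) :=
  exists U : nat -> set 'rV[R]_n,
    (forall i, (i < k)%N -> open (U i) /\ null (U i)) /\
    (forall x, |K| x -> A x -> exists2 i, (i < k)%N & U i x).

Lemma null_coverable1 A : open A -> null A -> null_coverable 1 A.
Proof. by move=> oA nA; exists (fun=> A); split => // x _ Ax; exists 0%N. Qed.

Lemma null_coverable_sub k A B : A `<=` B -> null_coverable k B -> null_coverable k A.
Proof. by move=> AB [U [hU cU]]; exists U; split => // x Kx /AB; apply: cU. Qed.

Lemma null_coverableU k l A B : null_coverable k A -> null_coverable l B ->
  null_coverable (k + l) (A `|` B).
Proof.
move=> [U [hU cU]] [V [hV cV]].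
exists (fun i => if (i < k)%N then U i else V (i - k)%N); split.
  by move=> i ikl; case: ltnP => ik; [exact: hU|apply: hV; rewrite ltn_subLR].
move=> x Kx [/(cU _ Kx) [i ik Ui]|/(cV _ Kx) [i il Vi]].
  by exists i; rewrite ?ik // (leq_trans ik) // leq_addr.
exists (k + i)%N; first by rewrite ltn_add2l.
by rewrite ltnNge leq_addr /= addKn.
Qed.

Section TopRanked.
Variables (c : nat) (W : {set 'I_n}).
Implicit Type x : 'rV[R]_n.
Hypothesis hY : forall i y, (i <= c)%N -> @trivial_homotopy_set R Y i y.

(** A continuous weight that is positive exactly at the vertices of [W] where
    the coordinate of [x] is positive and at most [c] other coordinates in [W]
    are as large: the factor of a set [s] vanishes if no vertex of [s] has a
    smaller coordinate than [i]. *)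
Definition rank_weight x : 'rV[R]_n := \row_i if i \in W then
  x 0 i * \prod_(s : {set 'I_n} | [&& s \subset W, #|s| == c.+2 & i \in s])
            \sum_(l in s) Num.max 0 (x 0 i - x 0 l) else 0.

Lemma rank_weight_ge0 x i : |K| x -> 0 <= rank_weight x 0 i.
Proof.
case=> x0 _ _; rewrite mxE; case: ifP => // _; rewrite mulr_ge0 // prodr_ge0 // => s _.
by rewrite sumr_ge0 // => l _; rewrite le_max lexx.
Qed.

Lemma support_rank_weight x : support (rank_weight x) \subset support x.
Proof.
apply/supportP => i; rewrite inE negbK mxE => /eqP ->.
by rewrite mul0r; case: ifP.
Qed.

Lemma rank_weight_neq0 x (s : {set 'I_n}) i :
  rank_weight x 0 i != 0 -> s \subset W -> #|s| = c.+2 -> i \in s ->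
  exists2 l, l \in s & x 0 l < x 0 i.
Proof.
move=> ri sW sc si; apply/exists_inP; apply: contraNT ri.
rewrite negb_exists_in => /forall_inP h; rewrite mxE; case: ifP => // _.
rewrite (bigD1 s) /=; last by rewrite sW sc eqxx.
rewrite big1 ?mul0r ?mulr0 // => l ls.
have := h l ls; rewrite -leNgt => xl.
by rewrite max_l // subr_le0.
Qed.

(** At a vertex [i] of least coordinate in the support, all coordinates of the
    support are as large as that of [i]; there are at most [c + 1] of these. *)
Lemma card_support_rank_weight x : (#|support (rank_weight x)| <= c.+1)%N.
Proof.
rewrite leqNgt; apply/negP => big.
have [i0 i0T] : exists i, i \in support (rank_weight x).
  by apply/set0Pn; rewrite -card_gt0 (leq_trans _ big).
pose i := [arg min_(i < i0 in support (rank_weight x)) x 0 i]%O.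
have [iT imin] : i \in support (rank_weight x) /\
    forall l, l \in support (rank_weight x) -> x 0 i <= x 0 l.
  by rewrite /i; case: arg_minP.
have [|s sT sc] := @subset_of_card _ (support (rank_weight x) :\ i) c.+1.
  by move: big; rewrite (cardsD1 i) iT.
have isT : i |: s \subset support (rank_weight x).
  by rewrite finset.subUset finset.sub1set iT (fintype.subset_trans sT) // finset.subD1set.
have [||||l ls] := @rank_weight_neq0 x (i |: s) i.
- by rewrite inE in iT.
- apply: fintype.subset_trans isT _; apply/fintype.subsetP => l.
  by rewrite inE mxE; case: ifP => //; rewrite eqxx.
- rewrite cardsU1 sc; case: (boolP (i \in s)) => // /(fintype.subsetP sT).
  by rewrite !inE eqxx.
- by rewrite !inE eqxx.
by rewrite ltNge imin // (fintype.subsetP isT).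
Qed.

Definition low_rank : set 'rV[R]_n := [set x | 0 < \sum_i rank_weight x 0 i].

Lemma within_rank_weight (A : set 'rV[R]_n) : {within A, continuous rank_weight}.
Proof.
apply: within_mx => k i.
apply: (@within_eq _ _ _ (fun x : 'rV[R]_n => if i \in W then
  x 0 i * \prod_(s : {set 'I_n} | [&& s \subset W, #|s| == c.+2 & i \in s])
            \sum_(l in s) Num.max 0 (x 0 i - x 0 l) else 0)) => [|x _]; last by rewrite mxE.
have cc l : {within A, continuous (fun x : 'rV[R]_n => x 0 l)}.
  by apply: within_coord; exact: within_id.
case: (i \in W); last exact: within_cst.
apply: within_mul => //; apply: within_prod => s _; apply: within_sum => l _.
by apply: within_max; [exact: within_cst|exact: within_sub_fun].
Qed.

Lemma open_low_rank : open low_rank.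
Proof.
apply: (@open_comp _ _ (fun x => \sum_i rank_weight x 0 i) [set t | 0 < t]);
  last exact: open_gt.
have h := (continuous_subspace_setT (fun x => \sum_i rank_weight x 0 i)).2
  (within_coord_sum (@within_rank_weight setT)).
by move=> x _; exact: h.
Qed.

(** Normalizing the weights deforms [low_rank] into the [c]-skeleton. *)
Lemma low_rank_nullhomotopic : null low_rank.
Proof.
pose r x := (\sum_i rank_weight x 0 i)^-1 *: rank_weight x.
have cr : {within |K| `&` low_rank, continuous r}.
  apply: within_normalize; last exact: within_rank_weight.
  by move=> x [_]; rewrite /low_rank /= => /lt0r_neq0.
have rn x : low_rank x -> (\sum_i rank_weight x 0 i)^-1 != 0.
  by move=> /lt0r_neq0; rewrite invr_eq0.
have rK x : (|K| `&` low_rank) x -> |K| (r x).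
  move=> [Kx lx]; apply: normalize_realization.
  - by move=> i; exact: rank_weight_ge0.
  - by rewrite -invr_eq0 rn.
  - by case: Kx => _ _ xK; apply: (fK xK); exact: support_rank_weight.
apply: (nullhomotopic_homotopic (g := f \o r)).
  apply: (@carrier_homotopic _ id) => //; first exact: within_id.
  move=> x Ax; split; [by case: Ax|exact: rK|].
  exists (support x); first by case: Ax => -[].
  split => //; rewrite support_scale ?support_rank_weight //.
  by apply: rn; case: Ax.
apply: (nullhomotopic_pullback cr) (skeleton_nullhomotopic fK cf Y0 hY).
move=> x Ax; split; first exact: rK.
by rewrite /= support_scale ?card_support_rank_weight //; apply: rn; case: Ax.
Qed.

(** For a subset [s] of [W], the open star of the barycenter of [s] in the
    barycentric subdivision, when only coordinates in [W] are considered. *)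
Definition dominated (s : {set 'I_n}) : set 'rV[R]_n :=
  [set x | forall i, i \in s -> 0 < x 0 i /\ forall l, l \in W -> l \notin s -> x 0 l < x 0 i].

Definition top_ranked_by (j : nat) (s : {set 'I_n}) : set 'rV[R]_n :=
  [set x | [/\ s \subset W, #|s| = j & dominated s x]].

Definition top_ranked (j : nat) : set 'rV[R]_n := \bigcup_s top_ranked_by j s.

Lemma open_dominated s : open (dominated s).
Proof.
rewrite openE => x dx.
pose P (i l : 'I_n) := [set y : 'rV[R]_n | i \in s ->
    0 < y 0 i /\ (l \in W -> l \notin s -> y 0 l < y 0 i)].
suff : nbhs x [set y | forall i l, P i l y].
  apply: filterS => y h i si; split; first by case: (h i i si).
  by move=> l; case: (h i l si).
have fx : Filter (nbhs x) by exact: nbhs_filter.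
apply: (@filter_forall _ _ (fun i y => forall l, P i l y) _ fx) => i.
apply: (@filter_forall _ _ (P i) _ fx) => l.
have [si|si] := boolP (i \in s); last by apply: nearW => y; rewrite /P /= (negPf si).
have [x0 xl] := dx i si.
have h1 : nbhs x [set y : 'rV[R]_n | 0 < y 0 i].
  by apply: open_nbhs_nbhs; split => //; exact: coord_gt0_open.
have [/andP[lW ls]|nl] := boolP ((l \in W) && (l \notin s)); last first.
  by apply: filterS h1 => y y0 _; split => // lW ls; rewrite lW ls in nl.
have h2 : nbhs x [set y : 'rV[R]_n | y 0 l < y 0 i].
  by apply: open_nbhs_nbhs; split; [exact: coord_lt_open|exact: xl].
by apply: filterS2 h1 h2 => y y0 yl _; split.
Qed.

Lemma open_top_ranked_by j s : open (top_ranked_by j s).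
Proof.
have [[sW sj]|no] := pselect (s \subset W /\ #|s| = j).
  rewrite (_ : top_ranked_by j s = dominated s); first exact: open_dominated.
  by apply/seteqP; split => x // -[].
rewrite (_ : top_ranked_by j s = set0); first exact: open0.
by apply/seteqP; split => x // -[sW sj _]; case: no.
Qed.

Lemma open_top_ranked j : open (top_ranked j).
Proof. by apply: bigcup_open => s _; exact: open_top_ranked_by. Qed.

(** Neighborhoods of the barycenters of different simplices with the same number
    of vertices are disjoint: a vertex of the first simplex that is missing in
    the second would have both a larger and a smaller coordinate than a vertex
    of the second that is missing in the first. *)
Lemma top_ranked_nullhomotopic j : (0 < j)%N -> paths_exist R Y -> null (top_ranked j).
Proof.
move=> j0 pY; apply: nullhomotopic_disjoint => //.
- exact: open_top_ranked_by.
- move=> s; have [sK|sK] := boolP (s \in K).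
    apply: nullhomotopic_sub (open_star_nullhomotopic sK).
    move=> x [Kx [sW sj dx]]; split => //.
    have [i si] : exists i, i \in s by apply/set0Pn; rewrite -card_gt0 sj.
    by exists i => //; rewrite gt_eqF //; case: (dx i si).
  apply: nullhomotopic_empty => // x [[_ _ xK] [sW sj dx]].
  case/negP: sK; apply: (fK xK); apply/fintype.subsetP => i si.
  by rewrite inE gt_eqF //; case: (dx i si).
- move=> s t x _ [sW sj dsx] [tW tj dtx]; apply/eqP; rewrite eqEcard sj tj leqnn andbT.
  apply/negPn/negP => st.
  have [i si nit] : exists2 i, i \in s & i \notin t by apply/fintype.subsetPn.
  have [l tl nls] : exists2 l, l \in t & l \notin s.
    apply/fintype.subsetPn; apply: contra st => ts.
    have /eqP -> : t == s by rewrite eqEcard ts sj tj leqnn.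
    exact: fintype.subxx.
  have [_ /(_ l (fintype.subsetP tW _ tl) nls)] := dsx i si.
  have [_ /(_ i (fintype.subsetP sW _ si) nit)] := dtx l tl.
  by move=> /lt_trans h /h; rewrite ltxx.
Qed.

(** Consider the set [s] of vertices of [W] where the coordinate of [x] is
    maximal.  If it has at most [c + 1] elements, they have positive weight; if
    not, [x] lies in the neighborhood of the barycenter of [s]. *)
Lemma low_rank_or_top_ranked x : |K| x -> open_star W x ->
  low_rank x \/ exists s, [/\ s \in K, s \subset W, (c.+1 < #|s|)%N & top_ranked #|s| x].
Proof.
move=> Kx [i1 i1W xi1].
pose i0 := [arg max_(i > i1 in W) x 0 i]%O.
have [i0W imax] : i0 \in W /\ forall l, l \in W -> x 0 l <= x 0 i0.
  by rewrite /i0; case: arg_maxP.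
have x0 l : 0 <= x 0 l by case: Kx.
have xi0 : 0 < x 0 i0 by rewrite (lt_le_trans _ (imax _ i1W)) // lt_neqAle eq_sym xi1 x0.
pose s := [set i in W | x 0 i == x 0 i0]%SET.
have sW : s \subset W by apply/fintype.subsetP => i; rewrite inE => /andP[].
have [sc|sc] := leqP #|s| c.+1; [left|right].
  rewrite /low_rank /= (bigD1 i0) //= ltr_wpDr //.
    by apply: sumr_ge0 => i _; apply: rank_weight_ge0.
  rewrite mxE i0W mulr_gt0 // prodr_gt0 // => t /and3P[tW /eqP tc ti].
  have [l tl xl] : exists2 l, l \in t & l \notin s.
    apply/fintype.subsetPn; apply: contraL sc => /subset_leq_card.
    by rewrite tc -ltnNge.
  rewrite (bigD1 l) //= ltr_wpDr //.
    by apply: sumr_ge0 => k _; rewrite le_max lexx.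
  have lW := fintype.subsetP tW _ tl.
  rewrite lt_max ltxx /= subr_gt0 lt_neqAle imax // andbT.
  by move: xl; rewrite inE lW.
exists s; split => //.
  case: Kx => _ _ xK; apply: (fK xK); apply/fintype.subsetP => i.
  by rewrite !inE => /andP[_ /eqP ->]; rewrite gt_eqF.
exists s => //; split => // i; rewrite inE => /andP[iW /eqP ->]; split => // l lW.
by rewrite inE lW /= => xl; rewrite lt_neqAle xl imax.
Qed.

(** One set for the [c]-skeleton, and one for each of the [m] numbers of vertices
    [c + 2, ..., c + m + 1]. *)
Lemma low_dim_null_coverable m :
  (forall s, s \in K -> s \subset W -> (#|s| <= c + m.+1)%N) ->
  null_coverable m.+1 (open_star W).
Proof.
move=> Wdim; have pY : paths_exist R Y by apply: trivial_pi0_paths => y; apply: hY.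
pose U i := if i is j.+1 then top_ranked (c + j.+2) else low_rank.
exists U; split => [[|j] _|x Kx Wx].
- by split; [exact: open_low_rank|exact: low_rank_nullhomotopic].
- split; first exact: open_top_ranked.
  by apply: top_ranked_nullhomotopic; rewrite // addnS.
have [lx|[s [sK sW sc sx]]] := low_rank_or_top_ranked Kx Wx; first by exists 0%N.
have := Wdim s sK sW => sm; exists (#|s| - c - 1)%N; first by lia.
have -> : (#|s| - c - 1 = (#|s| - c - 2).+1)%N by lia.
by rewrite /U; have -> : (c + (#|s| - c - 2).+2 = #|s|)%N by lia.
Qed.

End TopRanked.

(** The number of vertices from which on [greedy_null_coverable] needs [k] sets.
    The step to [k] removes a simplex with [c + k] vertices, except for [k = 1],
    where it suffices that there is a vertex at all. *)
Fixpoint vertex_bound (c k : nat) : nat :=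
  match k with
  | 0 => 0
  | 1 => 1
  | k'.+1 => (vertex_bound c k' + (c + k))%N
  end.

Lemma vertex_boundSS c k : (vertex_bound c k.+2 = vertex_bound c k.+1 + (c + k.+2))%N.
Proof. by []. Qed.

Section Greedy.
Variable c : nat.
Hypothesis hY : forall i y, (i <= c)%N -> @trivial_homotopy_set R Y i y.

Lemma greedy_null_coverable k (W : {set 'I_n}) :
  (#|W| < vertex_bound c k.+1)%N -> null_coverable k (open_star W).
Proof.
elim: k W => [|k IH] W.
  rewrite ltnS leqn0 cards_eq0 => /eqP ->; exists (fun=> set0); split => // x _ [i].
  by rewrite inE.
rewrite vertex_boundSS => Wc.
have [/forall_inP h|/forall_inPn [s sK]] :=
    boolP [forall s in K, (s \subset W) ==> (#|s| <= c + k.+1)%N].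
  by apply: (low_dim_null_coverable hY) => s sK sW; have := h s sK; rewrite sW.
rewrite negb_imply -ltnNge => /andP[sW sc].
have -> : k.+1 = (k + 1)%N by rewrite addn1.
apply: (@null_coverable_sub _ _ (open_star (W :\: s) `|` open_star s)).
  move=> x [i iW xi]; have [si|si] := boolP (i \in s); [right|left]; exists i => //.
  by rewrite inE si.
apply: null_coverableU.
  apply: IH; have := cardsD W s; rewrite (finset.setIidPr sW) => ->.
  by have := subset_leq_card sW; lia.
by apply: null_coverable1; [exact: open_open_star|exact: open_star_nullhomotopic].
Qed.

(** The least number of sets that covers the points off the star of [s] is
    taken, so that there are enough vertices outside [s]. *)
Lemma exists_null_cover s : s \in K ->
  exists k, (#|s| + vertex_bound c k <= n)%N /\ null_coverable k.+1 setT.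
Proof.
move=> sK; have vb k : (k <= vertex_bound c k)%N.
  by elim: k => [|[|k] IHk] //; rewrite vertex_boundSS; lia.
have ex : exists k, (n - #|s| < vertex_bound c k.+1)%N.
  by exists (n - #|s|)%N; apply: vb.
case: (ex_minnP ex) => k kP kmin; exists k; split.
  have sn : (#|s| <= n)%N by rewrite -[n in (_ <= n)%N]card_ord max_card.
  case: k kP kmin => [|k] kP kmin; first by rewrite addn0.
  have [h|] := ltnP (n - #|s|) (vertex_bound c k.+1).
    by have := kmin k h; rewrite ltnn.
  by move: (vertex_bound c k.+1) => b; lia.
have h1 : null_coverable k (open_star (~: s)%SET).
  by apply: greedy_null_coverable; rewrite finset.cardsCs finset.setCK card_ord.
have h2 := null_coverable1 (@open_open_star s) (open_star_nullhomotopic sK).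
have [U [hU cU]] := null_coverableU h1 h2.
exists U; rewrite -addn1; split => // x Kx _; apply: (cU _ Kx).
have [i xi] : exists i, x 0 i != 0.
  by have /rV0Pn := realization_neq0 Kx.
have [si|si] := boolP (i \in s); [right|left]; exists i => //.
by rewrite inE si.
Qed.

End Greedy.
End Covers.

(** * Simplices of full dimension *)

Lemma polyhedral_convex (R : realType) m (I : finType) (P : set 'rV[R]_m)
    (p : I -> 'rV[R]_m) (w : I -> R) :
  polyhedral_set P -> (forall i, P (p i)) -> (forall i, 0 <= w i) -> \sum_i w i = 1 ->
  P (\sum_i w i *: p i).
Proof.
move=> [k [A [b ->]]] Pp w0 w1 j; rewrite mulmx_suml summxE.
rewrite -[leRHS]mul1r -w1 mulr_suml; apply: ler_sum => i _.
by rewrite -scalemxAl mxE ler_wpM2l //; apply: Pp.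
Qed.

Lemma affine_on_convex (R : realType) m n (I : finType) (P : set 'rV[R]_m)
    (g : 'rV[R]_m -> 'rV[R]_n) (p : I -> 'rV[R]_m) (w : I -> R) :
  affine_on P g -> (forall i, P (p i)) -> \sum_i w i = 1 -> P (\sum_i w i *: p i) ->
  g (\sum_i w i *: p i) = \sum_i w i *: g (p i).
Proof.
move=> [A [b gE]] Pp w1 Ps; rewrite gE // mulmx_suml.
have -> : b = \sum_i w i *: b by rewrite -scaler_suml w1 scale1r.
rewrite -big_split /=; apply: eq_bigr => i _.
by rewrite gE // scalerDr scalemxAl.
Qed.

(** Separating the positive from the negative coefficients, an affine dependence
    of the images says that two convex combinations have the same image; by
    injectivity they agree, which is the same dependence of the points. *)
Lemma affine_injective_dependence (R : realType) m n (I : finType) (P : set 'rV[R]_m)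
    (g : 'rV[R]_m -> 'rV[R]_n) (p : I -> 'rV[R]_m) (a : I -> R) :
  polyhedral_set P -> affine_on P g -> (forall x y, P x -> P y -> g x = g y -> x = y) ->
  (forall i, P (p i)) -> \sum_i a i = 0 -> \sum_i a i *: g (p i) = 0 ->
  \sum_i a i *: p i = 0.
Proof.
move=> polP affP injg Pp a0 ag.
pose u i := Num.max (a i) 0; pose v i := Num.max (- a i) 0.
have auv i : a i = u i - v i.
  rewrite /u /v; case: (lerP 0 (a i)) => ai.
    by rewrite max_r ?subr0 // oppr_le0.
  by rewrite max_l ?sub0r ?opprK // oppr_ge0 ltW.
have u0 i : 0 <= u i by rewrite /u le_max lexx orbT.
have v0 i : 0 <= v i by rewrite /v le_max lexx orbT.
have uv : \sum_i u i = \sum_i v i.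
  apply/subr0_eq; rewrite -sumrB -[RHS]a0.
  by apply: eq_bigr => i _; rewrite auv.
have split_sum k (h : I -> 'rV[R]_k) :
    \sum_i a i *: h i = \sum_i u i *: h i - \sum_i v i *: h i.
  by rewrite -sumrB; apply: eq_bigr => i _; rewrite auv scalerBl.
have [s0|s0] := eqVneq (\sum_i u i) 0.
  have z (w : I -> R) : (forall i, 0 <= w i) -> \sum_i w i = 0 -> forall i, w i = 0.
    move=> w0 /eqP; rewrite psumr_eq0 => [|i _ //].
    by move=> /allP h i; apply/eqP/h; rewrite mem_index_enum.
  rewrite big1 // => i _; rewrite auv (z u) // (z v) -?uv //.
  by rewrite subrr scale0r.
have key w : (forall i, 0 <= w i) -> \sum_i w i = \sum_i u i ->
    P (\sum_i ((\sum_i u i)^-1 * w i) *: p i) /\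
    g (\sum_i ((\sum_i u i)^-1 * w i) *: p i) = (\sum_i u i)^-1 *: \sum_i w i *: g (p i).
  move=> w0 wu; have w1 : \sum_i ((\sum_i u i)^-1 * w i) = 1.
    by rewrite -mulr_sumr wu mulVf.
  have Ps : P (\sum_i ((\sum_i u i)^-1 * w i) *: p i).
    by apply: polyhedral_convex => // i; rewrite mulr_ge0 // invr_ge0 sumr_ge0.
  split => //; rewrite (affine_on_convex affP) // scaler_sumr.
  by apply: eq_bigr => i _; rewrite scalerA.
have [Pu gu] := key u u0 erefl; have [Pv gv] := key v v0 (esym uv).
have e : \sum_i ((\sum_i u i)^-1 * u i) *: p i = \sum_i ((\sum_i u i)^-1 * v i) *: p i.
  apply: injg => //; rewrite gu gv; congr (_ *: _); apply/eqP.
  by rewrite -subr_eq0 -split_sum ag.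
have pull w : \sum_i ((\sum_i u i)^-1 * w i) *: p i = (\sum_i u i)^-1 *: \sum_i w i *: p i.
  by rewrite scaler_sumr; apply: eq_bigr => i _; rewrite scalerA.
move: e; rewrite !pull => /(scalerI _) e; rewrite split_sum e ?subrr //.
by rewrite invr_eq0.
Qed.

Lemma small_support_dependence (R : realType) n d (q : 'I_d -> 'rV[R]_n) (s : {set 'I_n}) :
  (#|s| < d)%N -> (forall i, support (q i) \subset s) ->
  exists2 a : 'rV[R]_d, a != 0 & \sum_i a 0 i *: q i = 0.
Proof.
move=> sd qs; pose Q : 'M[R]_(d, #|s|) := \matrix_(i, k) q i 0 (enum_val k).
have : kermx Q != 0.
  by rewrite kermx_eq0 /row_free neq_ltn (leq_ltn_trans (rank_leq_col Q)).
move=> /rowV0Pn [a /sub_kermxP aQ a0]; exists a => //.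
apply/rowP => l; rewrite summxE mxE; have [ls|nls] := boolP (l \in s).
  have /rowP /(_ (enum_rank_in ls l)) := aQ; rewrite !mxE => e; rewrite -[RHS]e.
  by apply: eq_bigr => i _; rewrite !mxE enum_rankK_in.
by apply: big1 => i _; rewrite mxE (supportP _ _ (qs i)) ?mulr0.
Qed.

Lemma moment_curve_free (R : realType) d (t : 'I_d -> R) (a : 'I_d -> R) :
  injective t -> (forall l : 'I_d, \sum_i a i * t i ^+ l = 0) -> forall i, a i = 0.
Proof.
move=> t_inj h; pose V := Vandermonde d (\row_i t i).
have uV : V \in unitmx.
  rewrite unitmxE det_Vandermonde unitfE; apply/prodf_neq0 => i _; apply/prodf_neq0 => k ik.
  rewrite !mxE subr_eq0; apply: contraTneq ik => /t_inj ->.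
  by rewrite ltnn.
have : V *m (\col_i a i) = 0.
  apply/colP => l; rewrite !mxE -[RHS](h l); apply: eq_bigr => i _.
  by rewrite !mxE mulrC.
move=> /(congr1 (mulmx (invmx V))); rewrite mulKmx // mulmx0 => /colP e i.
by have := e i; rewrite !mxE.
Qed.

Lemma finite_cover_infinite_class (I : Type) (C : set I) (F : I -> set nat) N :
  finite_set C -> (forall k, (N <= k)%N -> exists2 i, C i & F i k) ->
  exists2 i, C i & infinite_set (F i).
Proof.
move=> finC h; apply: contrapT => no.
have : finite_set (`I_N `|` \bigcup_(i in C) F i).
  rewrite finite_setU; split; first exact: finite_II.
  by apply: bigcup_finite => // i Ci; apply: contrapT => inf; apply: no; exists i.
apply: contra_not infinite_nat => fin; apply: sub_finite_set fin => k _.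
by case: (ltnP k N) => [|/h]; [left|right].
Qed.

(** Consider infinitely many points on a moment curve in the facet of the simplex
    boundary that is opposite to the last vertex.  Infinitely many of them lie in
    the same linear piece and have images in the same simplex [s].  If [s] had
    less than [d] vertices, [d] of the images would be dependent, and then so
    would be the points. *)
Lemma combinatorial_sphere_dim (R : realType) d n (L : {set {set 'I_n}}) :
  (0 < d)%N -> @combinatorial_sphere R d n L -> exists2 s, s \in L & (d <= #|s|)%N.
Proof.
move=> d0 [f [g [[cf cg fK gK] _ plg]]]; apply: contrapT => small.
pose z (t : R) : 'rV[R]_d.+1 := \row_i (if (i < d)%N then t ^+ i else 0).
pose p t := (\sum_i z t 0 i)^-1 *: z t.
have z_ge0 t i : 0 < t -> 0 <= z t 0 i.
  by move=> t0; rewrite mxE; case: ifP => // _; rewrite exprn_ge0 // ltW.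
have z_sum t : 0 < t -> \sum_i z t 0 i != 0.
  move=> t0; rewrite psumr_neq0; last by move=> i _; apply: z_ge0.
  apply/hasP; exists ord0; rewrite ?mem_index_enum //= mxE d0 expr0.
  exact: ltr01.
pose B := @realization R d.+1 (simplex_boundary d).
have pB t : 0 < t -> B (p t).
  move=> t0; apply: normalize_realization => [i||]; [exact: z_ge0|exact: z_sum|].
  rewrite inE; apply/eqP => /setP /(_ ord_max).
  by rewrite !inE mxE ltnn eqxx.
(* Parameters tending to 1, so that the points of the curve approach [p 1]. *)
pose t k : R := 1 + harmonic k.
have t_gt0 k : 0 < t k by rewrite /t addr_gt0 // invr_gt0 ltr0n.
have t_inj : injective t.
  move=> k l /addrI /invr_inj /eqP; rewrite eqr_nat => /eqP [] //.
have pt_cvg : p (t k) @[k --> \oo] --> p 1.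
  have cp : {within [set u : R | 0 < u], continuous p}.
    apply: within_normalize => //; apply: within_mx => k i.
    apply: (@within_eq _ _ _ (fun u : R => if (i < d)%N then u ^+ i else 0)) => [|u _];
      last by rewrite mxE.
    case: (i < d)%N; last exact: within_cst.
    by apply: continuous_subspaceT => u; apply: exprn_continuous.
  have t_cvg : t k @[k --> \oo] --> (1 : R).
    by rewrite -[X in _ --> X]addr0; apply: cvgD; [exact: cvg_cst|exact: cvg_harmonic].
  apply: (cvg_comp _ _ t_cvg).
  have /subspace_continuousP /(_ 1 ltr01) := cp; rewrite within_interior //.
  by apply: open_nbhs_nbhs; split; [exact: open_gt|exact: ltr01].
have [C [finC hC coverC]] := plg _ (pB 1 ltr01).
have [N hN] : exists N, forall k, (N <= k)%N -> exists2 P, C P & P (p (t k)).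
  have [N _ hN] := pt_cvg _ coverC; exists N => k Nk.
  by have [P CP Pk] := hN k Nk (pB _ (t_gt0 k)); exists P.
have [[P s] /= CP inf] : exists2 Ps : set 'rV[R]_d.+1 * {set 'I_n}, C Ps.1 &
    infinite_set [set k | Ps.1 (p (t k)) /\ support (g (p (t k))) = Ps.2].
  have [|k Nk|[P s] [CP _] inf] := @finite_cover_infinite_class _ (C `*` setT)
     (fun Ps => [set k | Ps.1 (p (t k)) /\ support (g (p (t k))) = Ps.2]) N.
  - by apply: finite_setX => //; exact: finite_finset.
  - have [P CP Pk] := hN k Nk; by exists (P, support (g (p (t k)))).
  - by exists (P, s).
have [polP PB affP] := hC P CP.
have [E Esub dE] := infinite_set_fset d inf.
pose kk (i : 'I_d) := nth 0%N (finmap.enum_fset E) i.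
have kkE i : kk i \in finmap.enum_fset E by apply: mem_nth; apply: leq_trans dE.
have kkP i : P (p (t (kk i))) /\ support (g (p (t (kk i)))) = s by apply: Esub; apply: kkE.
have kk_inj : injective kk.
  move=> i j /eqP; rewrite nth_uniq ?finmap.fset_uniq ?(leq_trans _ dE) // => /eqP e.
  exact: val_inj.
have sL : s \in L.
  have [_ <-] := kkP (Ordinal d0).
  by have [[_ _ +] _] := gK _ (pB _ (t_gt0 (kk (Ordinal d0)))).
have sd : (#|s| < d)%N by rewrite ltnNge; apply/negP => ds; apply: small; exists s.
have qs i : support (g (p (t (kk i)))) \subset s.
  by have [_ ->] := kkP i; exact: fintype.subxx.
have [a a0 aq] := small_support_dependence sd qs.
(* The dependence is affine since barycentric coordinates add up to 1. *)
have asum : \sum_i a 0 i = 0.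
  have := congr1 (fun v : 'rV[R]_n => \sum_l v 0 l) aq.
  rewrite /= [RHS]big1; last by move=> l _; rewrite mxE.
  move=> e; rewrite -[RHS]e; under [RHS]eq_bigr do rewrite summxE.
  rewrite exchange_big /=; apply: eq_bigr => i _.
  under eq_bigr do rewrite mxE; rewrite -mulr_sumr.
  have [[_ -> _] _] := gK _ (pB _ (t_gt0 (kk i))).
  by rewrite mulr1.
have injg x y : P x -> P y -> g x = g y -> x = y.
  move=> Px Py e; have [_ <-] := gK _ (PB _ Px); have [_ <-] := gK _ (PB _ Py).
  by rewrite e.
have dep := affine_injective_dependence polP affP injg (fun i => (kkP i).1) asum aq.
have a_eq0 i : a 0 i * (\sum_l z (t (kk i)) 0 l)^-1 = 0.
  move: i; apply: (@moment_curve_free R d (t \o kk)) => [|l].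
    exact: inj_comp.
  have /rowP /(_ (widen_ord (leqnSn d) l)) := dep; rewrite summxE mxE => e.
  rewrite -[RHS]e; apply: eq_bigr => i _; rewrite /p scalerA [RHS]mxE.
  by rewrite [z _ 0 _]mxE /= ltn_ord.
case/negP: a0; apply/eqP/rowP => i; rewrite mxE.
have /eqP := a_eq0 i; rewrite mulf_eq0 invr_eq0 => /orP[/eqP //|].
by rewrite (negPf (z_sum _ (t_gt0 _))).
Qed.

(** * Counting vertices *)

Lemma vertex_boundE (R : realType) (c k : nat) :
  (vertex_bound c k.+1)%:R = c%:R * k%:R + k.+1%:R * k.+2%:R / 2 :> R.
Proof.
elim: k => [|k IH]; first by rewrite mulr0 add0r mul1r divff.
by rewrite vertex_boundSS natrD IH natrD -!natr1; field.
Qed.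

Lemma least_ge0 (R : realType) (S : set nat) : (0 <= @least R S)%E.
Proof. by apply: le_ereal_inf_tmp => _ [k _ <-]; rewrite lee_fin ler0n. Qed.

Lemma least_le (R : realType) (S : set nat) k : S k -> (@least R S <= k%:R%:E)%E.
Proof. by move=> Sk; apply: ereal_inf_lbound; exists k. Qed.

Lemma lscat_le_null_cover (R : realType) (M : topologicalType) n
    (K : {set {set 'I_n}}) (f : 'rV[R]_n -> M) (g : M -> 'rV[R]_n) k :
  homeomorphism_on (@realization R n K) [set: M] f g ->
  null_coverable K f k setT -> (lscat R M <= k%:R%:E)%E.
Proof.
move=> [cf cg fK gK] [U [hU cU]]; apply: least_le.
have gc : continuous g by apply/continuous_subspace_setT.
exists (fun i : 'I_k => g @^-1` U i); split.
  move=> i; have [oU [y hH]] := hU i (ltn_ord i); split.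
    by apply: open_comp => // x _; exact: gc.
  exists y; apply: (@homotopic_eql _ _ _ _ (f \o g)).
    by move=> x _; case: (gK x I).
  apply: (@homotopic_pullback R _ _ _ _ _ g f (cst y) _ _ hH).
    exact: continuous_subspaceT.
  by move=> x Ux; split => //; case: (gK x I).
apply/seteqP; split => x // _.
have [Kx _] := gK x I.
by have [i ik Ui] := cU (g x) Kx I; exists (Ordinal ik).
Qed.

(** The join of a vertex with a large simplex of its link. *)
Lemma triangulation_simplex (R : realType) d (M : closedPLManifold R d) n
    (K : {set {set 'I_n}}) :
  [set: M] !=set0 -> combinatorial_triangulation M K ->
  exists2 s, s \in K & (d < #|s|)%N.
Proof.
move=> [x _] [[K0 Kv fK] [f [g [_ _ _ gK]]] hlink].
have [v _] : exists v : 'I_n, (g x) 0 v != 0.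
  by have [Kx _] := gK x I; have /rV0Pn := realization_neq0 Kx.
case: (posnP d) => [->|d0]; first by exists [set v]%SET; rewrite ?cards1.
have [s + ds] := combinatorial_sphere_dim d0 (hlink v).
rewrite inE => /andP[vs vsK]; exists (v |: s)%SET => //.
by rewrite cardsU1 vs.
Qed.

Local Open Scope ereal_scope.

Theorem corollary2p4 (R : realType) (c d : nat) (M : closedPLManifold R d)
    (hc : @n_connected R c M) :
  1 + d%:R%:E + c%:R%:E * (lscat R M - 2%:E)
    + (2^-1)%:E * lscat R M * (lscat R M - 1) <= DeltaPL M.
Proof.
have [M0 hM] := hc; apply: le_ereal_inf_tmp => _ [n [K trK] <-].
have [s sK ds] := triangulation_simplex M0 trK.
case: trK => -[_ _ fK] [f [g fg]] _; have [cf _ _ _] := fg.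
have [k [nk cover]] := exists_null_cover fK cf M0 (fun i y => hM i y) sK.
have := lscat_le_null_cover fg cover; have : 0 <= lscat R M := least_ge0 _ _.
case: (lscat R M) => [r| |] //; rewrite !lee_fin => r0 rk.
have {}nk : (d%:R + 1 + (vertex_bound c k)%:R <= n%:R :> R)%R.
  by rewrite natr1 -natrD ler_nat; apply: leq_trans nk; rewrite leq_add2r.
have c0 : (0 <= c%:R :> R)%R := ler0n _ c.
case: k nk rk {cover} => [|k] nk rk.
  by rewrite addr0 in nk; nra.
have k1 : (k.+1%:R = k%:R + 1 :> R)%R by rewrite natr1.
have k2 : (k.+2%:R = k%:R + 2 :> R)%R by rewrite -addn2 natrD.
rewrite vertex_boundE in nk; rewrite k1 k2 in nk; rewrite k2 in rk.
have k0 : (0 <= k%:R :> R)%R := ler0n _ k.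
have h1 : (c%:R * r <= c%:R * (k%:R + 2))%R by rewrite ler_wpM2l.
(* [r (r - 1)] is at most its value at the integer [k + 2]. *)
have h2 : (0 <= (k%:R + 2 - r) * (k%:R + 1 + r))%R by rewrite mulr_ge0 //; lra.
lra.
Qed.
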